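(* Consider the problem $\min_{x\in\mathcal X,\,y\in\mathcal Y}\{p_1(x_1)+f(x)+q_1(y_1)+g(y)\ :\ \mathcal A^*x+\mathcal B^*y=c\}$ and the algorithm sGS-imiPADMM, both described in the context. Assume that: (i) the solution set $\overline{\mathcal W}$ of the KKT system of the problem is nonempty; (ii) $\widehat\Sigma_f:\mathcal X\to\mathcal X$ and $\widehat\Sigma_g:\mathcal Y\to\mathcal Y$ are self-adjoint positive semidefinite linear operators such that, for all $x,x'\in\mathcal X$ and $y,y'\in\mathcal Y$, $f(x)\le f(x')+\langle\nabla f(x'),x-x'\rangle+\frac12\|x-x'\|^2_{\widehat\Sigma_f}$ and $g(y)\le g(y')+\langle\nabla g(y'),y-y'\rangle+\frac12\|y-y'\|^2_{\widehat\Sigma_g}$; (iii) $\widetilde{\mathcal S}:\mathcal X\to\mathcal X$ and $\widetilde{\mathcal T}:\mathcal Y\to\mathcal Y$ are self-adjoint linear operators (not necessarily positive semidefinite) with $\widetilde{\mathcal S}\succeq-\frac12\widehat\Sigma_f$, $\widetilde{\mathcal T}\succeq-\frac12\widehat\Sigma_g$, and whose diagonal blocks satisfy $(\widehat\Sigma_f)_{ii}+\sigma\mathcal A_i\mathcal A_i^*+\widetilde{\mathcal S}_{ii}\succ0$ for $i=1,\dots,m$ and $(\widehat\Sigma_g)_{jj}+\sigma\mathcal B_j\mathcal B_j^*+\widetilde{\mathcal T}_{jj}\succ0$ for $j=1,\dots,n$; and that $\widetilde{\mathcal S}$ and $\widetilde{\mathcal T}$ are chosen such that $$\tfrac12\widehat\Sigma_f+\sigma\mathcal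 A\mathcal A^*+\mathcal S_{\rm sGS}\succ0\quad\text{and}\quad\tfrac12\widehat\Sigma_g+\sigma\mathcal B\mathcal B^*+\mathcal T_{\rm sGS}\succ0,$$ where $\mathcal S_{\rm sGS}$ and $\mathcal T_{\rm sGS}$ are defined in the context. Then the whole sequence $\{(x^k,y^k,z^k)\}$ generated by sGS-imiPADMM converges to a solution of the KKT system of the problem, i.e., to a point of $\overline{\mathcal W}$.
   Context: **Problem.** $\mathcal X=\mathcal X_1\times\cdots\times\mathcal X_m$, $\mathcal Y=\mathcal Y_1\times\cdots\times\mathcal Y_n$ and $\mathcal Z$ are finite dimensional real Hilbert spaces with inner product $\langle\cdot,\cdot\rangle$ and induced norm $\|\cdot\|$ (each factor inherits the inner product); $x=(x_1,\dots,x_m)$, $y=(y_1,\dots,y_n)$. $p_1:\mathcal X_1\to(-\infty,\infty]$, $q_1:\mathcal Y_1\to(-\infty,\infty]$ are closed proper convex functions; $f:\mathcal X\to\mathbb R$, $g:\mathcal Y\to\mathbb R$ are convex and continuously differentiable with Lipschitz continuous gradients; $\mathcal A:\mathcal Z\to\mathcal X$, $\mathcal B:\mathcal Z\to\mathcal Y$ are linear with adjoints $\mathcal A^*,\mathcal B^*$; $c\in\mathcal Z$. Put $p(x):=p_1(x_1)$, $q(y):=q_1(y_1)$. Write $\mathcal Az=(\mathcal A_1z,\dots,\mathcal A_mz)$ and $\mathcal Bz=(\mathcal B_1z,\dots,\mathcal B_nz)$ with $\mathcal A_iz\in\mathcal X_i$, $\mathcal B_jz\in\mathcal Y_j$. $\sigma>0$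 is a given constant. **KKT system.** $0\in\partial p(x)+\nabla f(x)+\mathcal Az$, $\ 0\in\partial q(y)+\nabla g(y)+\mathcal Bz$, $\ \mathcal A^*x+\mathcal B^*y=c$. Its set of solutions $(x,y,z)\in\mathcal X\times\mathcal Y\times\mathcal Z$ is $\overline{\mathcal W}$. **Operator notation.** For a self-adjoint $\mathcal H$, $\|u\|_{\mathcal H}^2:=\langle u,\mathcal Hu\rangle$ (possibly negative if $\mathcal H$ is indefinite); $\succeq$, $\succ$ denote the positive semidefinite/definite orders. Self-adjoint operators on $\mathcal X$ (resp. $\mathcal Y$) are written in block form according to the decomposition of $\mathcal X$ (resp. $\mathcal Y$), with $(i,j)$ block denoted by subscript $ij$. Define $\widetilde{\mathcal M}:=\widehat\Sigma_f+\sigma\mathcal A\mathcal A^*+\widetilde{\mathcal S}$ and $\widetilde{\mathcal N}:=\widehat\Sigma_g+\sigma\mathcal B\mathcal B^*+\widetilde{\mathcal T}$. Let $\widetilde{\mathcal M}_d,\widetilde{\mathcal N}_d$ be their block-diagonal parts and $\widetilde{\mathcal M}_u,\widetilde{\mathcal N}_u$ their strictly upper block-triangular parts, so $\widetilde{\mathcal M}=\widetilde{\mathcal M}_d+\widetilde{\mathcal M}_u+\widetilde{\mathcal M}_u^*$, and similarly for $\widetilde{\mathcal N}$. (Under (iii), $\widetilde{\mathcal M}_d,\widetilde{\mathcal N}_d\succ0$.) Define $$\mathcal S_{\rm sGS}:=\widetilde{\mathcal S}+\widetilde{\mathcal M}_u\widetilde{\mathcal M}_d^{-1}\widetilde{\mathcal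 M}_u^*,\qquad\mathcal T_{\rm sGS}:=\widetilde{\mathcal T}+\widetilde{\mathcal N}_u\widetilde{\mathcal N}_d^{-1}\widetilde{\mathcal N}_u^*.$$ **Majorized proximal augmented Lagrangian.** With $\hat f(x;x'):=f(x')+\langle\nabla f(x'),x-x'\rangle+\frac12\|x-x'\|^2_{\widehat\Sigma_f}$ and $\hat g(y;y'):=g(y')+\langle\nabla g(y'),y-y'\rangle+\frac12\|y-y'\|^2_{\widehat\Sigma_g}$, $$\widetilde{\mathcal L}_\sigma(x,y;(x',y',z')):=p(x)+\hat f(x;x')+q(y)+\hat g(y;y')+\langle z',\mathcal A^*x+\mathcal B^*y-c\rangle+\tfrac\sigma2\|\mathcal A^*x+\mathcal B^*y-c\|^2+\tfrac12\|x-x'\|^2_{\widetilde{\mathcal S}}+\tfrac12\|y-y'\|^2_{\widetilde{\mathcal T}}.$$ **Algorithm sGS-imiPADMM.** Let $\tau\in(0,(1+\sqrt5)/2)$, let $\{\tilde\varepsilon_k\}_{k\ge0}$ be a summable sequence of nonnegative numbers, and let $(x^0,y^0,z^0)\in\operatorname{dom}p\times\operatorname{dom}q\times\mathcal Z$. Write $w^k:=(x^k,y^k,z^k)$, and $u_{\le i}$, $u_{\ge i}$ for the blocks of $u$ with index $\le i$, $\ge i$ respectively. For $k=0,1,\dots$: Step 1a (backward sweep). For $i=m,\dots,2$, compute an approximate minimizer $\tilde x_i^{k+1}$ of $x_i\mapsto\widetilde{\mathcal L}_\sigma((x^k_{\le i-1},x_i,\tilde x^{k+1}_{\ge i+1}),y^k;w^k)$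 over $\mathcal X_i$, in the sense that there is $\tilde\delta_i^k\in\partial_{x_i}\widetilde{\mathcal L}_\sigma((x^k_{\le i-1},\tilde x_i^{k+1},\tilde x^{k+1}_{\ge i+1}),y^k;w^k)$ with $\|\tilde\delta_i^k\|\le\tilde\varepsilon_k$. Step 1b (forward sweep). For $i=1,\dots,m$, compute an approximate minimizer $x_i^{k+1}$ of $x_i\mapsto\widetilde{\mathcal L}_\sigma((x^{k+1}_{\le i-1},x_i,\tilde x^{k+1}_{\ge i+1}),y^k;w^k)$ over $\mathcal X_i$, in the sense that there is $\delta_i^k\in\partial_{x_i}\widetilde{\mathcal L}_\sigma((x^{k+1}_{\le i-1},x_i^{k+1},\tilde x^{k+1}_{\ge i+1}),y^k;w^k)$ with $\|\delta_i^k\|\le\tilde\varepsilon_k$. Step 2a (backward sweep). For $j=n,\dots,2$, compute an approximate minimizer $\tilde y_j^{k+1}$ of $y_j\mapsto\widetilde{\mathcal L}_\sigma(x^{k+1},(y^k_{\le j-1},y_j,\tilde y^{k+1}_{\ge j+1});w^k)$ over $\mathcal Y_j$, in the sense that there is $\tilde\gamma_j^k\in\partial_{y_j}\widetilde{\mathcal L}_\sigma(x^{k+1},(y^k_{\le j-1},\tilde y_j^{k+1},\tilde y^{k+1}_{\ge j+1});w^k)$ with $\|\tilde\gamma_j^k\|\le\tilde\varepsilon_k$. Step 2b (forward sweep). For $j=1,\dots,n$, compute an approximate minimizer $y_j^{k+1}$ of $y_j\mapsto\widetilde{\mathcal L}_\sigma(x^{k+1},(y^{k+1}_{\le j-1},y_j,\tilde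 y^{k+1}_{\ge j+1});w^k)$ over $\mathcal Y_j$, in the sense that there is $\gamma_j^k\in\partial_{y_j}\widetilde{\mathcal L}_\sigma(x^{k+1},(y^{k+1}_{\le j-1},y_j^{k+1},\tilde y^{k+1}_{\ge j+1});w^k)$ with $\|\gamma_j^k\|\le\tilde\varepsilon_k$. Step 3. $z^{k+1}:=z^k+\tau\sigma(\mathcal A^*x^{k+1}+\mathcal B^*y^{k+1}-c)$. Here $\partial_{x_i}$, $\partial_{y_j}$ denote the convex subdifferential with respect to the indicated block. *)

(* Defs.v *)
From HB Require Import structures.
From mathcomp Require Import all_boot all_order all_algebra.
From mathcomp Require Import sesquilinear ring lra.
From mathcomp Require Import all_classical all_reals all_analysis.
Import Order.TTheory GRing.Theory Num.Theory.
Import numFieldNormedType.Exports VectorInternalTheory.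

Set Implicit Arguments.
Unset Strict Implicit.
Unset Printing Implicit Defensive.

Local Open Scope classical_set_scope.
Local Open Scope ring_scope.

(* Finite dimensional real Hilbert spaces: finite dimensional normed spaces   *)
(* whose norm, hence whose topology, is induced by a positive definite        *)
(* symmetric bilinear form. Completeness is automatic.                        *)
HB.mixin Record NormedModule_hasInner (R : realType) V of NormedModule R V := {
  inner_dot : {dot V for (@idfun R)} ;
  inner_dot_norm : forall x : V, inner_dot x x = `|x| ^+ 2
}.

#[short(type="euclideanType")]
HB.structure Definition Euclidean (R : realType) :=
  { V of NormedModule R V & Vector R V & NormedModule_hasInner R V }.

Definition inner (R : realType) (V : euclideanType R) (u v : V) : R :=
  inner_dot u v.

Section InnerTheory.
Context {R : realType} {V : euclideanType R}.
Implicit Types u v w : V.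

Lemma innerC u v : inner u v = inner v u.
Proof. by rewrite /inner (@hermitian_subproof _ _ _ _ inner_dot) expr0 mul1r. Qed.

Lemma inner_linear u : linear_for *%R (inner u).
Proof. by move=> a v w; rewrite /inner linearD linearZ. Qed.

HB.instance Definition _ u :=
  GRing.isLinear.Build R V R *%R (inner u) (inner_linear u).

Lemma innerDl u v w : inner (u + v) w = inner u w + inner v w.
Proof. by rewrite innerC linearD /= innerC (innerC w). Qed.

Lemma innerZl a u w : inner (a *: u) w = a * inner u w.
Proof. by rewrite innerC linearZ /= innerC. Qed.

Lemma inner_norm u : inner u u = `|u| ^+ 2.
Proof. exact: inner_dot_norm. Qed.

Lemma inner_eq0 u : (inner u u == 0) = (u == 0).
Proof. by rewrite inner_norm sqrf_eq0 normr_eq0. Qed.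

Lemma inner_inj u v : (forall w, inner u w = inner v w) -> u = v.
Proof.
move=> uv; apply/eqP; rewrite -subr_eq0 -inner_eq0 -scaleN1r.
by rewrite innerDl innerZl uv mulN1r subrr.
Qed.

Lemma riesz (l : V -> R) : linear_for *%R l ->
  exists v, forall u, l u = inner v u.
Proof.
move=> llin.
pose lL : {linear V -> R^o} := HB.pack l
  (GRing.isLinear.Build R V R^o *:%R l llin).
pose phi (v : V) : 'Hom(V, R^o) := linfun (inner v : V -> R^o).
have phiE v u : phi v u = inner v u.
  pose iL : {linear V -> R^o} := HB.pack (inner v : V -> R^o)
    (GRing.isLinear.Build R V R^o *:%R (inner v) (inner_linear v)).
  exact: (lfunE iL).
have philin : linear phi.
  move=> a u v; apply/lfunP => w.
  by rewrite add_lfunE scale_lfunE !phiE innerDl innerZl.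
pose phiL : {linear V -> 'Hom(V, R^o)} := HB.pack phi
  (GRing.isLinear.Build R V 'Hom(V, R^o) *:%R phi philin).
have ker0 : lker (linfun phiL) == 0%VS.
  apply/lker0P => u v; rewrite !lfunE /= => uv.
  by apply: inner_inj => w; rewrite -!phiE uv.
have full : limg (linfun phiL) = fullv.
  apply/eqP; rewrite eqEdim subvf /= limg_dim_eq; last first.
    by rewrite (eqP ker0) capv0.
  by rewrite !dimvf /dim /= muln1.
have /memv_imgP[v _ vE] : linfun lL \in limg (linfun phiL).
  by rewrite full memvf.
exists v => u.
by rewrite -phiE -[phi v]/(phiL v) -(lfunE phiL) -vE lfunE.
Qed.

End InnerTheory.

Definition adjoint (R : realType) (V W : euclideanType R) (A : 'Hom(V, W)) :
    'Hom(W, V) :=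
  xget 0 [set B : 'Hom(W, V) | forall v w, inner (A v) w = inner v (B w)].

Lemma adjointP (R : realType) (V W : euclideanType R) (A : 'Hom(V, W)) v w :
  inner (A v) w = inner v (adjoint A w).
Proof.
suff [B BP] : exists B : 'Hom(W, V),
    forall v w, inner (A v) w = inner v (B w).
  exact: (@xgetPex _ 0 [set B : 'Hom(W, V) |
    forall v w, inner (A v) w = inner v (B w)] (ex_intro _ B BP)).
have ex w' : exists v', forall u, inner w' (A u) = inner v' u.
  by apply: riesz => a u1 u2; rewrite linearP /= linearD /= linearZ.
have [b bE] := choice ex.
have blin : linear b.
  move=> a u1 u2; apply: inner_inj => u.
  by rewrite innerDl innerZl -!bE innerDl innerZl.
pose bL : {linear W -> V} := HB.pack b
  (GRing.isLinear.Build R W V *:%R b blin).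
by exists (linfun bL) => v' w'; rewrite lfunE /= innerC bE innerC.
Qed.

(* R as a Hilbert space, so that R^n is hprod (fun _ : 'I_n => R^o).          *)
Section ScalarHilbert.
Context {R : realType}.

Definition scalar_inner (a b : R^o) : R := a * b.

Fact scalar_inner_bilinear : bilinear_for *%R (@idfun R \; *%R) scalar_inner.
Proof.
by split=> a b u v; rewrite /scalar_inner /= /GRing.scale /=; ring.
Qed.

HB.instance Definition _ := bilinear_isBilinear.Build R R^o R^o R *%R
  (@idfun R \; *%R) scalar_inner scalar_inner_bilinear.

Fact scalar_inner_hermitian (a b : R^o) :
  scalar_inner a b = (-1) ^+ false * @idfun R (scalar_inner b a).
Proof. by rewrite expr0 mul1r /scalar_inner mulrC. Qed.

HB.instance Definition _ := isHermitianSesquilinear.Build R R^o false (@idfun R)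
  scalar_inner scalar_inner_hermitian.

Fact scalar_inner_gt0 (a : R^o) : a != 0 -> 0 < scalar_inner a a.
Proof. by move=> a0; rewrite /scalar_inner -expr2 exprn_even_gt0. Qed.

HB.instance Definition _ :=
  isDotProduct.Build R R^o scalar_inner scalar_inner_gt0.

Fact scalar_inner_norm (a : R^o) :
  (scalar_inner : {dot R^o for (@idfun R)}) a a = `|a| ^+ 2.
Proof. by rewrite -normrX ger0_norm ?sqr_ge0 //= /scalar_inner expr2. Qed.

HB.instance Definition _ :=
  NormedModule_hasInner.Build R R^o scalar_inner_norm.

End ScalarHilbert.

(* The product X_1 x ... x X_n, with inner product sum_i <u_i, v_i>.          *)
Definition hprod (R : realType) (n : nat) (X : 'I_n -> euclideanType R) : Type :=
  {dffun forall i, X i}.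

Section HilbertProduct.
Context {R : realType} {n : nat} (X : 'I_n -> euclideanType R).
Local Notation P := (hprod X).
Implicit Types u v w : P.

HB.instance Definition _ := Choice.copy P {dffun forall i, X i}.

Definition hprod_tuple (g : forall i, X i) : P := [ffun i => g i].

Lemma hprod_tupleE g i : hprod_tuple g i = g i.
Proof. exact: ffunE. Qed.

Lemma hprodP u v : (forall i, u i = v i) -> u = v.
Proof. by move=> uv; apply/ffunP. Qed.

Let addp u v := hprod_tuple (fun i => u i + v i).
Let oppp u := hprod_tuple (fun i => - u i).
Let zerop := hprod_tuple (fun i => 0).
Let scalep (a : R) u := hprod_tuple (fun i => a *: u i).

Fact addpA : associative addp.
Proof. by move=> u v w; apply: hprodP => i; rewrite !ffunE addrA. Qed.
Fact addpC : commutative addp.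
Proof. by move=> u v; apply: hprodP => i; rewrite !ffunE addrC. Qed.
Fact add0p : left_id zerop addp.
Proof. by move=> u; apply: hprodP => i; rewrite !ffunE add0r. Qed.
Fact addNp : left_inverse zerop oppp addp.
Proof. by move=> u; apply: hprodP => i; rewrite !ffunE addNr. Qed.

HB.instance Definition _ := GRing.isZmodule.Build P addpA addpC add0p addNp.

Fact scalepA a b u : scalep a (scalep b u) = scalep (a * b) u.
Proof. by apply: hprodP => i; rewrite !ffunE scalerA. Qed.
Fact scale1p : left_id 1 scalep.
Proof. by move=> u; apply: hprodP => i; rewrite !ffunE scale1r. Qed.
Fact scalepDr : right_distributive scalep +%R.
Proof. by move=> a u v; apply: hprodP => i; rewrite !ffunE scalerDr. Qed.
Fact scalepDl u : {morph scalep^~ u : a b / a + b}.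
Proof. by move=> a b; apply: hprodP => i; rewrite !ffunE scalerDl. Qed.

HB.instance Definition _ :=
  GRing.Zmodule_isLmodule.Build R P scalepA scale1p scalepDr scalepDl.

Lemma hprodDE u v i : (u + v) i = u i + v i. Proof. exact: ffunE. Qed.
Lemma hprodZE a u i : (a *: u) i = a *: u i. Proof. exact: ffunE. Qed.
Lemma hprod0E i : (0 : P) i = 0. Proof. exact: ffunE. Qed.

Fact hprod_vect : Vector.axiom (\sum_i dim (X i)) P.
Proof.
exists (fun u => \mxrow_i v2r (u i)).
  move=> a u v; apply/mxrowP => i.
  rewrite submxrowD !mxrowK hprodDE hprodZE linearP; congr (_ + _).
  apply/rowP => j; rewrite !mxE.
  by have /rowP/(_ j) := mxrowK (fun k => v2r (u k)) i; rewrite !mxE => ->.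
exists (fun r => hprod_tuple (fun i => r2v (submxrow r i))) => [u|r].
  by apply: hprodP => i; rewrite ffunE mxrowK v2rK.
apply/mxrowP => i; by rewrite mxrowK ffunE r2vK.
Qed.

HB.instance Definition _ := Lmodule_hasFinDim.Build R P hprod_vect.

Definition hprod_inner u v : R := \sum_i inner (u i) (v i).

Fact hprod_innerC u v : hprod_inner u v = hprod_inner v u.
Proof. by apply: eq_bigr => i _; rewrite innerC. Qed.

Fact hprod_inner_linear u : linear_for *%R (hprod_inner u).
Proof.
move=> a v w; rewrite /hprod_inner mulr_sumr -big_split /=.
by apply: eq_bigr => i _; rewrite hprodDE hprodZE linearD linearZ.
Qed.

Fact hprod_innerDr u v w :
  hprod_inner u (v + w) = hprod_inner u v + hprod_inner u w.
Proof. by rewrite -[v]scale1r hprod_inner_linear mul1r scale1r. Qed.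

Fact hprod_innerZr a u v : hprod_inner u (a *: v) = a * hprod_inner u v.
Proof.
rewrite /hprod_inner mulr_sumr; apply: eq_bigr => i _.
by rewrite hprodZE linearZ.
Qed.

Fact hprod_inner_bilinear : bilinear_for *%R (@idfun R \; *%R) hprod_inner.
Proof.
split=> [v|u] a u1 u2 /=; last exact: hprod_inner_linear.
by rewrite hprod_innerC hprod_inner_linear !(hprod_innerC v).
Qed.

HB.instance Definition _ := bilinear_isBilinear.Build R P P R *%R
  (@idfun R \; *%R) hprod_inner hprod_inner_bilinear.

Fact hprod_inner_hermitian u v :
  hprod_inner u v = (-1) ^+ false * @idfun R (hprod_inner v u).
Proof. by rewrite expr0 mul1r hprod_innerC. Qed.

HB.instance Definition _ := isHermitianSesquilinear.Build R P false (@idfun R)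
  hprod_inner hprod_inner_hermitian.

Fact hprod_inner_ge0 u : 0 <= hprod_inner u u.
Proof. by apply: sumr_ge0 => i _; rewrite inner_norm sqr_ge0. Qed.

Fact hprod_inner_gt0 u : u != 0 -> 0 < hprod_inner u u.
Proof.
move=> u0; rewrite lt_neqAle hprod_inner_ge0 andbT eq_sym.
apply: contra u0 => /eqP u0; apply/eqP/hprodP => i; rewrite hprod0E.
apply/eqP; rewrite -inner_eq0; apply/eqP; move: i isT.
by apply: (psumr_eq0P _ u0) => i _; rewrite inner_norm sqr_ge0.
Qed.

HB.instance Definition _ := isDotProduct.Build R P hprod_inner hprod_inner_gt0.

Definition hprod_norm u : R := Num.sqrt (hprod_inner u u).

Fact hprod_cauchy_schwarz u v :
  hprod_inner u v <= hprod_norm u * hprod_norm v.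
Proof.
have [->|u0] := eqVneq u 0.
  have i0 w : hprod_inner 0 w = 0.
    by rewrite /hprod_inner big1// => i _; rewrite hprod0E innerC linear0.
  by rewrite /hprod_norm !i0 sqrtr0 mul0r.
have := hprod_inner_gt0 u0; set a := hprod_inner u u => a0.
set b := hprod_inner u v; set c := hprod_inner v v.
have /= : 0 <= hprod_inner (a *: v - b *: u) (a *: v - b *: u).
  exact: hprod_inner_ge0.
have -> : hprod_inner (a *: v - b *: u) (a *: v - b *: u) = a * (a * c - b ^+ 2).
  have e x y s t : hprod_inner (s *: x + t *: y) (s *: x + t *: y) =
      s ^+ 2 * hprod_inner x x + s * t * hprod_inner x y *+ 2
      + t ^+ 2 * hprod_inner y y.
    rewrite hprod_innerDr !hprod_innerZr.
    rewrite !(hprod_innerC (s *: x + t *: y)) !hprod_innerDr !hprod_innerZr.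
    rewrite (hprod_innerC y x).
    by rewrite mulr2n; ring.
  by rewrite -scaleNr e -/a -/c [hprod_inner v u]hprod_innerC -/b mulr2n; ring.
rewrite pmulr_rge0// subr_ge0 => bac.
rewrite /hprod_norm -/a -/c -sqrtrM ?(ltW a0)//; apply: (le_trans (ler_norm b)).
by rewrite -sqrtr_sqr ler_wsqrtr.
Qed.

Fact hprod_normD u v : hprod_norm (u + v) <= hprod_norm u + hprod_norm v.
Proof.
have n0 w : 0 <= hprod_norm w by exact: sqrtr_ge0.
rewrite -(@ler_pXn2r _ 2)// ?nnegrE ?addr_ge0// sqrrD.
rewrite !sqr_sqrtr ?hprod_inner_ge0//.
rewrite hprod_innerDr !(hprod_innerC (u + v)) !hprod_innerDr (hprod_innerC v u).
have := hprod_cauchy_schwarz u v; rewrite mulr2n; lra.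
Qed.

Fact hprod_normZ (a : R) u : hprod_norm (a *: u) = `|a| * hprod_norm u.
Proof.
rewrite /hprod_norm (_ : hprod_inner _ _ = a ^+ 2 * hprod_inner u u).
  by rewrite sqrtrM ?sqr_ge0// sqrtr_sqr.
rewrite /hprod_inner mulr_sumr; apply: eq_bigr => i _.
by rewrite hprodZE linearZ /= innerZl mulrA.
Qed.

Fact hprod_norm_eq0 u : hprod_norm u = 0 -> u = 0.
Proof.
move=> /eqP; rewrite sqrtr_eq0 => u0; apply/eqP; apply: contraTT u0.
by move=> /hprod_inner_gt0; rewrite ltNge.
Qed.

HB.instance Definition _ :=
  Lmodule_isNormed.Build R P hprod_normD hprod_normZ hprod_norm_eq0.

Fact hprod_inner_norm u :
  (hprod_inner : {dot P for (@idfun R)}) u u = `|u| ^+ 2.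
Proof. by rewrite sqr_sqrtr ?hprod_inner_ge0. Qed.

HB.instance Definition _ :=
  NormedModule_hasInner.Build R P hprod_inner_norm.

Lemma hprod_innerE u v : inner u v = \sum_i inner (u i) (v i).
Proof. by []. Qed.

Definition hproj_fun i u : X i := u i.

Definition hinj_fun i (v : X i) : P := hprod_tuple (eqtype.dfwith (fun j => 0 : X j) v).

Fact hproj_linear i : linear (hproj_fun i).
Proof. by move=> a u v; rewrite /hproj_fun hprodDE hprodZE. Qed.

Fact hinj_linear i : linear (@hinj_fun i).
Proof.
move=> a u v; apply: hprodP => j; rewrite hprodDE hprodZE !hprod_tupleE.
have [ij|ij] := eqVneq i j.
  by move: u v; case: _ / ij => u v; rewrite !dfwith_in.
by rewrite !dfwith_out// scaler0 addr0.
Qed.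

HB.instance Definition _ i :=
  GRing.isLinear.Build R P (X i) *:%R (hproj_fun i) (hproj_linear i).
HB.instance Definition _ i :=
  GRing.isLinear.Build R (X i) P *:%R (@hinj_fun i) (@hinj_linear i).

Definition hproj i : 'Hom(P, X i) := linfun (hproj_fun i).
Definition hinj i : 'Hom(X i, P) := linfun (@hinj_fun i).

Lemma hprojE i u : hproj i u = u i.
Proof. by rewrite lfunE. Qed.

Lemma hinjE i (v : X i) : hinj i v = hprod_tuple (eqtype.dfwith (fun j => 0 : X j) v).
Proof. by rewrite lfunE. Qed.

(* (u_1, .., u_{i-1}, a, v_{i+1}, .., v_n)                                    *)
Definition splice i u (a : X i) v : P :=
  hprod_tuple (eqtype.dfwith (fun j : 'I_n => if (j < i)%N then u j else v j) a).

Section Blocks.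
Local Open Scope lfun_scope.

Definition block (M : 'End(P)) i j : 'Hom(X j, X i) :=
  hproj i \o M \o hinj j.

Definition block_diag (M : 'End(P)) : 'End(P) :=
  \sum_i (hinj i \o block M i i \o hproj i).

Definition block_upper (M : 'End(P)) : 'End(P) :=
  \sum_(i < n) \sum_(j < n | (i < j)%N) (hinj i \o block M i j \o hproj j).

End Blocks.

End HilbertProduct.

Section Operators.
Context {R : realType} {V : euclideanType R}.
Implicit Types H G : 'End(V).

Definition self_adjoint H := adjoint H = H.

Definition qform H (u : V) : R := inner u (H u).

Definition psd H := forall u, 0 <= qform H u.

Definition pd H := forall u, u != 0 -> 0 < qform H u.

Definition loewner_le G H := psd (H - G).

End Operators.

Section ConvexAnalysis.
Context {R : realType} {V : euclideanType R}.
Local Open Scope ereal_scope.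

Definition dom (phi : V -> \bar R) : set V := [set x | phi x < +oo].

Definition closed_proper_convex (phi : V -> \bar R) :=
  [/\ forall x, -oo < phi x,
      dom phi !=set0,
      forall (x y : V) (t : R), (0 <= t <= 1)%R ->
        phi (t *: x + (1 - t) *: y)%R <= t%:E * phi x + (1 - t)%:E * phi y
    & lower_semicontinuous phi].

(* For a proper phi the finiteness requirement is automatic.                  *)
Definition subdifferential (phi : V -> \bar R) (x : V) : set V :=
  [set v | phi x \is a fin_num /\
           forall y, phi x + (inner v (y - x)%R)%:E <= phi y].

Definition grad (f : V -> R) (x : V) : V :=
  xget 0%R [set v | forall h, 'd f x h = inner v h].

Lemma gradP (f : V -> R) (x h : V) : 'd f x h = inner (grad f x) h.
Proof.
have [v vP] : exists v, forall h, 'd f x h = inner v h.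
  by apply: riesz => a u v; rewrite linearP.
exact: (@xgetPex _ 0%R [set v | forall h, 'd f x h = inner v h]
  (ex_intro _ v vP)).
Qed.

Definition convex_C1_lipschitz_grad (f : V -> R) :=
  [/\ convex_function (setT : set (convex_lmodType V)) f,
      forall x, differentiable f x,
      continuous (grad f)
    & lipschitz (grad f)].

End ConvexAnalysis.

Section Algorithm.
Context {R : realType}.

Definition prox_hessian (V Z : euclideanType R) (A : 'Hom(Z, V)) (sigma : R)
    (Sigma S : 'End(V)) : 'End(V) :=
  Sigma + sigma *: (A \o adjoint A)%VF + S.

(* S_sGS := S + M_u M_d^-1 M_u^* with M := Sigma + sigma A A^* + S.           *)
(* (M_d^-1)%VF is the inverse of M_d as soon as M_d is positive definite.     *)
Definition sGS_operator (n : nat) (X : 'I_n -> euclideanType R)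
    (Z : euclideanType R) (A : 'Hom(Z, hprod X)) (sigma : R)
    (Sigma S : 'End(hprod X)) : 'End(hprod X) :=
  let M := prox_hessian A sigma Sigma S in
  S + (block_upper M \o (block_diag M)^-1 \o adjoint (block_upper M))%VF.

(* p(x) := p_1(x_1): the m blocks are numbered from 0, so ord0 is the first.  *)
Definition first_block (n : nat) (X : 'I_n.+1 -> euclideanType R)
    (p1 : X ord0 -> \bar R) (x : hprod X) : \bar R := p1 (x ord0).

Definition majorant (V : euclideanType R) (f : V -> R) (Sigma : 'End(V))
    (x x' : V) : R :=
  f x' + inner (grad f x') (x - x') + 2^-1 * qform Sigma (x - x').

Definition KKT_set (V W Z : euclideanType R)
    (p : V -> \bar R) (q : W -> \bar R) (f : V -> R) (g : W -> R)
    (A : 'Hom(Z, V)) (B : 'Hom(Z, W)) (c : Z) : set (V * W * Z) :=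
  [set w | let: (x, y, z) := w in
    [/\ exists2 u, subdifferential p x u & 0 = u + grad f x + A z,
        exists2 v, subdifferential q y v & 0 = v + grad g y + B z
      & adjoint A x + adjoint B y = c]].

Definition majorized_lagrangian (V W Z : euclideanType R)
    (p : V -> \bar R) (q : W -> \bar R) (f : V -> R) (g : W -> R)
    (A : 'Hom(Z, V)) (B : 'Hom(Z, W)) (c : Z) (sigma : R)
    (Sf S : 'End(V)) (Sg T : 'End(W)) (x : V) (y : W) (w' : V * W * Z) :
    \bar R :=
  let: (x', y', z') := w' in
  let r := adjoint A x + adjoint B y - c in
  (p x + (majorant f Sf x x')%:E + q y + (majorant g Sg y y')%:E
   + (inner z' r + sigma / 2 * `|r| ^+ 2
      + 2^-1 * qform S (x - x') + 2^-1 * qform T (y - y'))%R%:E)%E.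

(* One inexact symmetric Gauss-Seidel cycle on phi: a backward sweep over the *)
(* blocks m, .., 2 from u to ut, then a forward sweep over 1, .., m to v.     *)
(* The first block of ut is irrelevant.                                       *)
Definition sGS_cycle (n : nat) (X : 'I_n.+1 -> euclideanType R)
    (phi : hprod X -> \bar R) (eps : R) (u ut v : hprod X) : Prop :=
  (forall i : 'I_n.+1, i != ord0 ->
     exists2 d, subdifferential (fun a : X i => phi (splice u a ut)) (ut i) d
              & `|d| <= eps) /\
  (forall i : 'I_n.+1,
     exists2 d, subdifferential (fun a : X i => phi (splice v a ut)) (v i) d
              & `|d| <= eps).

(* xt and yt collect the intermediate points produced by the backward sweeps. *)
Definition sGS_imiPADMM (m n : nat) (X : 'I_m.+1 -> euclideanType R)
    (Y : 'I_n.+1 -> euclideanType R) (Z : euclideanType R)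
    (p1 : X ord0 -> \bar R) (q1 : Y ord0 -> \bar R)
    (f : hprod X -> R) (g : hprod Y -> R)
    (A : 'Hom(Z, hprod X)) (B : 'Hom(Z, hprod Y)) (c : Z) (sigma : R)
    (Sf S : 'End(hprod X)) (Sg T : 'End(hprod Y)) (tau : R) (eps : nat -> R)
    (x xt : nat -> hprod X) (y yt : nat -> hprod Y) (z : nat -> Z) : Prop :=
  let p := first_block p1 in
  let q := first_block q1 in
  let L := majorized_lagrangian p q f g A B c sigma Sf S Sg T in
  dom p (x 0%N) /\ dom q (y 0%N) /\
  forall k : nat,
    [/\ sGS_cycle (fun u => L u (y k) (x k, y k, z k)) (eps k)
          (x k) (xt k.+1) (x k.+1),
        sGS_cycle (fun v => L (x k.+1) v (x k, y k, z k)) (eps k)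
          (y k) (yt k.+1) (y k.+1)
      & z k.+1 = z k +
          (tau * sigma) *: (adjoint A (x k.+1) + adjoint B (y k.+1) - c)].

End Algorithm.

(* Main.v *)
Require Import Defs.
From HB Require Import structures.
From mathcomp Require Import all_boot all_order all_algebra.
From mathcomp Require Import ring lra.
From mathcomp Require Import all_classical all_reals all_analysis.
Import Order.TTheory GRing.Theory Num.Theory.
Import numFieldNormedType.Exports.

Set Implicit Arguments.
Unset Strict Implicit.
Unset Printing Implicit Defensive.

Local Open Scope classical_set_scope.
Local Open Scope ring_scope.

(**
Eliminating the backward sweep [ut] from the stacked optimality conditions of
one symmetric Gauss-Seidel cycle shows that the cycle is an inexact step of the
full block problem with the extra proximal term [M_u M_d^-1 M_u^*]. The
algorithm is thus an inexact two-block majorized proximal ADMM with proximal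
operators [S_sGS] and [T_sGS].

For the latter, monotonicity of the subdifferentials at a KKT point, together
with the cocoercivity of the gradients, yields a potential [P] (weighted squared
distances to the KKT point) with
[P_{k+1} + a_k <= P_k + eta_k (sqrt P_{k+1} + sqrt P_k)], where [eta] is summable
and [a_k] controls the residual and the increments. Hence [sqrt P] is
quasi-Fejer monotone, the iterates are bounded and [a_k -> 0]; so every cluster
point is a KKT point, and [P] taken relative to a cluster point tends to [0].
*)

Section InnerAlgebra.
Context {R : realType} {V : euclideanType R}.
Implicit Types u v w : V.

Lemma innerDr u v w : inner u (v + w) = inner u v + inner u w.
Proof. exact: linearD. Qed.

Lemma innerZr a u v : inner u (a *: v) = a * inner u v.
Proof. exact: linearZ. Qed.

Lemma innerNr u v : inner u (- v) = - inner u v.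
Proof. exact: linearN. Qed.

Lemma innerNl u v : inner (- u) v = - inner u v.
Proof. by rewrite innerC innerNr innerC. Qed.

Lemma innerBl u v w : inner (u - v) w = inner u w - inner v w.
Proof. by rewrite innerDl innerNl. Qed.

Lemma inner0r u : inner u 0 = 0.
Proof. exact: linear0. Qed.

Lemma inner0l u : inner 0 u = 0.
Proof. by rewrite innerC inner0r. Qed.

Lemma inner_ge0 u : 0 <= inner u u.
Proof. by rewrite inner_norm sqr_ge0. Qed.

End InnerAlgebra.

Definition innerE := (@innerDl, @innerDr, @innerNl, @innerNr, @innerZl, @innerZr).

Lemma discriminant_le0 (R : realFieldType) (a b c : R) : 0 <= c ->
  (forall t, 0 <= a + 2 * t * b + t ^+ 2 * c) -> b ^+ 2 <= a * c.
Proof.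
rewrite le_eqVlt => /predU1P[<-|c0] abc.
  have [->|b0] := eqVneq b 0; first by rewrite expr0n mulr0.
  have := abc (- (a + 1) / (2 * b)).
  have -> : a + 2 * (- (a + 1) / (2 * b)) * b + (- (a + 1) / (2 * b)) ^+ 2 * 0
    = -1 by field.
  lra.
have := abc (- b / c).
have -> : a + 2 * (- b / c) * b + (- b / c) ^+ 2 * c = (a * c - b ^+ 2) / c.
  by field; rewrite gt_eqF.
by rewrite pmulr_lge0 ?invr_gt0// subr_ge0.
Qed.

Section Forms.
Context {R : realType} {V : euclideanType R}.
Implicit Types (u v : V) (H : 'End(V)).

Lemma self_adjointP H :
  self_adjoint H <-> forall u v, inner u (H v) = inner (H u) v.
Proof.
split=> [sH u v|sH]; first by rewrite adjointP sH.
by apply/lfunP => v; apply: inner_inj => u; rewrite innerC -adjointP -sH innerC.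
Qed.

Lemma qformD H u v : self_adjoint H ->
  qform H (u + v) = qform H u + 2 * inner u (H v) + qform H v.
Proof.
move=> /self_adjointP sH; rewrite /qform linearD !innerE /= (sH v) (innerC (H v)).
ring.
Qed.

Lemma qformZ H a u : qform H (a *: u) = a ^+ 2 * qform H u.
Proof. by rewrite /qform linearZ /= !innerE mulrA. Qed.

Lemma qformN H u : qform H (- u) = qform H u.
Proof. by rewrite -scaleN1r qformZ sqrrN expr1n mul1r. Qed.

Lemma qformB H u v : self_adjoint H ->
  qform H (u - v) = qform H u - 2 * inner u (H v) + qform H v.
Proof. by move=> sH; rewrite qformD// qformN linearN !innerE mulrN. Qed.

Lemma qformDl H G u : qform (H + G) u = qform H u + qform G u.
Proof. by rewrite /qform add_lfunE innerDr. Qed.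

Lemma qformZl a H u : qform (a *: H) u = a * qform H u.
Proof. by rewrite /qform scale_lfunE innerZr. Qed.

Lemma psd_cauchy_schwarz H u v : self_adjoint H -> psd H ->
  inner u (H v) ^+ 2 <= qform H u * qform H v.
Proof.
move=> sH pH; apply: discriminant_le0 => [|t]; first exact: pH.
have := pH (u + t *: v); rewrite qformD// qformZ linearZ /= innerZr.
by rewrite mulrA.
Qed.

Lemma cauchy_schwarz u v : `|inner u v| <= `|u| * `|v|.
Proof.
rewrite -(@ler_pXn2r _ 2)// ?nnegrE ?mulr_ge0// -normrX ger0_norm ?sqr_ge0//.
rewrite exprMn -!inner_norm; apply: discriminant_le0 => [|t].
  exact: inner_ge0.
have := inner_ge0 (u + t *: v); rewrite !innerE (innerC v u).
congr (_ <= _); ring.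
Qed.

Lemma inner_le_norm u v : inner u v <= `|u| * `|v|.
Proof. by rewrite (le_trans (ler_norm _))// cauchy_schwarz. Qed.

Lemma qform_polarization H u v : self_adjoint H ->
  2 * inner (H (v - u)) v = qform H v - qform H u + qform H (v - u).
Proof.
move=> sH; rewrite qformB// /qform innerC linearB !innerE /=.
by rewrite [inner v (H u)](self_adjointP H).1// (innerC (H v)); ring.
Qed.

Lemma sqr_normB_le u v : `|u - v| ^+ 2 <= 2 * `|u| ^+ 2 + 2 * `|v| ^+ 2.
Proof.
have := inner_ge0 (u + v); rewrite -!inner_norm !innerE (innerC v u); lra.
Qed.

End Forms.

Section Hom.
Context {R : realType} {V W : euclideanType R}.

Lemma hom_bounded (L : 'Hom(V, W)) :
  exists2 C, 0 < C & forall u, `|L u| <= C * `|u|.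
Proof.
pose b := vbasis {:V}.
have ex (i : 'I_(\dim {:V})) : exists v, forall u, coord b i u = inner v u.
  by apply: riesz => a u v; rewrite linearP.
have [r rE] := choice ex.
exists (1 + \sum_i `|r i| * `|L b`_i|).
  by rewrite ltr_pwDl// sumr_ge0// => i _; rewrite mulr_ge0.
move=> u; rewrite mulrDl mul1r {1}(coord_vbasis (memvf u)) linear_sum /=.
rewrite (le_trans (ler_norm_sum _ _ _))// -[leLHS]add0r lerD// mulr_suml.
apply: ler_sum => i _; rewrite linearZ normrZ mulrAC ler_wpM2r// rE.
exact: cauchy_schwarz.
Qed.

End Hom.

Section PositiveDefinite.
Context {R : realType} {V : euclideanType R}.
Implicit Types (u v : V) (H : 'End(V)).

Lemma pd_psd H : pd H -> psd H.
Proof.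
move=> pH u; have [->|/pH/ltW//] := eqVneq u 0.
by rewrite /qform inner0l.
Qed.

Lemma pd_lker0 H : pd H -> lker H == 0%VS.
Proof.
move=> pH; apply/lker0P => u v uv; apply/eqP; rewrite -subr_eq0.
apply: contraT => /pH; rewrite /qform linearB /= uv subrr inner0r ltxx.
by [].
Qed.

Lemma pd_lower_bound H : self_adjoint H -> pd H ->
  exists2 l, 0 < l & forall u, l * `|u| ^+ 2 <= qform H u.
Proof.
move=> sH pH; have [C C0 HC] := hom_bounded (H^-1)%VF.
exists C^-1; first by rewrite invr_gt0.
move=> u; rewrite ler_pdivrMl//.
have [->|u0] := eqVneq u 0; first by rewrite /qform inner0l mulr0 normr0 expr0n.
have uE : H ((H^-1)%VF u) = u by rewrite lker0_lfunVK// pd_lker0.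
have := psd_cauchy_schwarz u ((H^-1)%VF u) sH (pd_psd pH).
rewrite uE inner_norm /qform uE => h.
have h2 : inner ((H^-1)%VF u) u <= C * `|u| ^+ 2.
  by rewrite (le_trans (inner_le_norm _ _))// expr2 mulrA ler_wpM2r.
have := ler_wpM2l (pd_psd pH u) h2; rewrite -/(qform H u) => h3.
have u2 : 0 < `|u| ^+ 2 by rewrite exprn_gt0 ?normr_gt0.
rewrite -(ler_pM2r u2); nra.
Qed.

End PositiveDefinite.

Section SelfAdjoint.
Context {R : realType} {V : euclideanType R}.
Implicit Types H G : 'End(V).

Lemma self_adjointD H G : self_adjoint H -> self_adjoint G -> self_adjoint (H + G).
Proof.
move=> /self_adjointP sH /self_adjointP sG; apply/self_adjointP => u v.
by rewrite !add_lfunE !innerE sH sG.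
Qed.

Lemma self_adjointZ a H : self_adjoint H -> self_adjoint (a *: H).
Proof.
move=> /self_adjointP sH; apply/self_adjointP => u v.
by rewrite !scale_lfunE !innerE sH.
Qed.

Lemma qform_comp_adjoint (Z : euclideanType R) (A : 'Hom(Z, V)) u :
  qform (A \o adjoint A)%VF u = `|adjoint A u| ^+ 2.
Proof. by rewrite /qform comp_lfunE innerC adjointP inner_norm. Qed.

Lemma self_adjoint_comp_adjoint (Z : euclideanType R) (A : 'Hom(Z, V)) :
  self_adjoint (A \o adjoint A)%VF.
Proof.
by apply/self_adjointP => u v; rewrite !comp_lfunE [LHS]innerC !(adjointP A) innerC.
Qed.

Lemma self_adjoint_inv H : self_adjoint H -> pd H -> self_adjoint (H^-1)%VF.
Proof.
move=> /self_adjointP sH pH; apply/self_adjointP => u v.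
have HK := lker0_lfunVK (pd_lker0 pH).
by rewrite -{1}(HK u) -sH HK.
Qed.

Lemma psd_inv H : self_adjoint H -> pd H -> psd (H^-1)%VF.
Proof.
move=> sH pH u; have HK := lker0_lfunVK (pd_lker0 pH).
by rewrite /qform -{1}(HK u) innerC; exact: pd_psd.
Qed.

End SelfAdjoint.

(** * Limits *)

Section Continuity.
Context {R : realType}.

Lemma hom_continuous (V W : euclideanType R) (L : 'Hom(V, W)) : continuous L.
Proof.
move=> u; have [C C0 LC] := hom_bounded L.
apply/cvgrPdist_lt => e e0; near=> v.
rewrite -linearB (le_lt_trans (LC _))// mulrC -ltr_pdivlMr//.
near: v; have /cvgrPdist_lt := @cvg_id V (nbhs u); apply.
by rewrite divr_gt0.
Unshelve. all: by end_near. Qed.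

Lemma inner_cvg (T : Type) (F : set_system T) (FF : Filter F)
    (V : euclideanType R) (u v : T -> V) (a b : V) :
  u @ F --> a -> v @ F --> b -> inner (u t) (v t) @[t --> F] --> inner a b.
Proof.
move=> ua vb.
have E (x y : V) : inner x y = 2^-1 * (`|x + y| ^+ 2 - `|x| ^+ 2 - `|y| ^+ 2).
  by rewrite -!inner_norm !innerE (innerC y x); field.
rewrite E; under eq_fun do rewrite E.
apply: cvgM; first exact: cvg_cst.
have norm2 (w : T -> V) l : w @ F --> l -> `|w t| ^+ 2 @[t --> F] --> `|l| ^+ 2.
  by move=> wl; rewrite expr2; under eq_fun do rewrite expr2;
    apply: cvgM; exact: cvg_norm.
by apply: cvgB; [apply: cvgB|]; apply: norm2 => //; exact: cvgD.
Qed.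

Lemma increasing_seq_cvg_oo (h : nat -> nat) : increasing_seq h -> h @ \oo --> \oo.
Proof.
move=> /increasing_seqP hi B [N _ NB]; exists N => // k /= Nk.
apply: NB => /=; apply: (leq_trans Nk); elim: k {Nk} => // k ih.
exact: leq_ltn_trans ih (hi k).
Qed.

Lemma bounded_subsequence_family (I : eqType) (s : seq I) (u : I -> nat -> R) :
  (forall i, bounded_fun (u i)) ->
  exists2 h : nat -> nat, increasing_seq h & {in s, forall i, cvgn (u i \o h)}.
Proof.
move=> ub; elim: s => [|i s [h hi sh]].
  by exists id.
have [|h' hi' ih'] := @bolzano_weierstrass R (u i \o h).
  have [M [Mr uM]] := ub i; exists M; split => // x Mx k _.
  by move: (uM x Mx) => /(_ (h k) Logic.I).
exists (h \o h') => [a b|j]; first by rewrite /= -hi' hi.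
rewrite inE => /predU1P[->//|/sh/cvg_ex[l jl]].
apply/cvg_ex; exists l; exact: cvg_comp (increasing_seq_cvg_oo hi') jl.
Qed.

Lemma bounded_subsequence (V : euclideanType R) (u : nat -> V) (M : R) :
  (forall k, `|u k| <= M) ->
  exists2 h : nat -> nat, increasing_seq h & cvgn (u \o h).
Proof.
move=> uM; pose b := vbasis {:V}.
have ex (i : 'I_(\dim {:V})) : exists v, forall w, coord b i w = inner v w.
  by apply: riesz => a w w'; rewrite linearP.
have [r rE] := choice ex.
have [|h hi hc] := @bounded_subsequence_family _ (enum 'I_(\dim {:V}))
    (fun i k => coord b i (u k)).
  move=> i; exists (`|r i| * M); split; first exact: num_real.
  move=> x Mx k _; rewrite /= rE (le_trans (cauchy_schwarz _ _))//.
  by rewrite (le_trans _ (ltW Mx))// ler_wpM2l.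
exists h => //; rewrite (_ : _ \o _ =
    fun k => \sum_i coord b i (u (h k)) *: b`_i); last first.
  by apply/funext => k; rewrite /= -(coord_vbasis (memvf _)).
elim: (index_enum _) => [|i r' ih].
  by under eq_fun do rewrite big_nil; exact: is_cvg_cst.
under eq_fun do rewrite big_cons; apply: is_cvgD ih.
by apply: is_cvgZr_tmp; apply: hc; rewrite mem_enum.
Qed.

Lemma hom_cvg (V W : euclideanType R) (L : 'Hom(V, W)) (u : nat -> V) (l : V) :
  u @ \oo --> l -> L (u k) @[k --> \oo] --> L l.
Proof. by move=> ul; apply: continuous_cvg => //; exact: hom_continuous. Qed.

Lemma qform_cvg0 (V : euclideanType R) (H : 'End(V)) (u : nat -> V) :
  u @ \oo --> 0 -> qform H (u k) @[k --> \oo] --> 0.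
Proof.
by move=> u0; have := inner_cvg _ u0 (hom_cvg (L := H) u0); rewrite inner0l; apply.
Qed.

Lemma sqr_norm_cvg0 (V : euclideanType R) (u : nat -> V) :
  u @ \oo --> 0 -> `|u k| ^+ 2 @[k --> \oo] --> 0.
Proof.
move=> u0; have := inner_cvg _ u0 u0; rewrite inner0r.
by under eq_fun do rewrite inner_norm; apply.
Qed.

End Continuity.

Section Convexity.
Context {R : realType} {V : euclideanType R}.

Lemma convex_grad_le (f : V -> R) x y : convex_C1_lipschitz_grad f ->
  f x + inner (grad f x) (y - x) <= f y.
Proof.
move=> [cf df _ _]; rewrite -lerBrDl -gradP.
apply/ler_addgt0Pr => e e0.
have dx : derivable f x (y - x) by exact: diff_derivable.
move: (dx); rewrite /derivable -/(derivable f x (y - x)) => /cvg_ex[l lP].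
have lE : l = 'd f x (y - x) by rewrite -deriveE//; apply/esym/cvg_lim.
rewrite -lE; move/cvgrPdist_lt : lP => /(_ e e0)[r /= r0 rP].
pose t := Num.min (r / 2) 1.
have t0 : 0 < t by rewrite lt_min divr_gt0//=.
have t1 : t <= 1 by rewrite ge_min lexx orbT.
have tr : t < r by rewrite gt_min; apply/orP; left; lra.
have := rP t; rewrite /= sub0r normrN gtr0_norm// => /(_ tr).
rewrite (gt_eqF t0) => /(_ isT).
have := cf (Itv01 (ltW t0) t1) y x (in_setT _) (in_setT _).
rewrite convRE /= /conv /= /unstable.onem.
have -> : t *: y + (1 - t) *: x = t *: (y - x) + x.
  by rewrite scalerBr scalerBl scale1r addrA addrAC.
move=> h; rewrite ltr_norml => /andP[_ h2].
have h3 : f (t *: (y - x) + x) - f x <= t * (f y - f x) by lra.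
have : t^-1 *: (f (t *: (y - x) + x) - f x) <= f y - f x.
  by rewrite /GRing.scale /= ler_pdivrMl.
by rewrite /GRing.scale /= in h2 *; lra.
Qed.

(* Add the majorant bounds expressing that [y] minimizes [f - <grad f y, ->],
   tested at [x + (z - x)/2], and that [x] minimizes [f - <grad f x, ->], tested
   at [y - (z - x)/2]; the majorant at [z] alone would only give [1/2]. *)
Lemma grad_cocoercive (f : V -> R) (Sig : 'End(V)) (x y z : V) :
  convex_C1_lipschitz_grad f -> (forall u u', f u <= majorant f Sig u u') ->
  - (4^-1 * qform Sig (z - x)) <= inner (grad f x - grad f y) (z - y).
Proof.
move=> cf mf; pose h := 2^-1 *: (z - x).
have := le_trans (convex_grad_le y (x + h) cf) (mf (x + h) x).
have := le_trans (convex_grad_le x (y - h) cf) (mf (y - h) y).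
rewrite /majorant (addrC x h) addrK (addrC y (- h)) addrK qformN /h qformZ.
move: (grad f x) (grad f y) => gx gy.
rewrite !innerE; lra.
Qed.

End Convexity.

Lemma le_of_le_add_scaled (R : realFieldType) (a b c : R) :
  (forall t, 0 < t <= 1 -> a <= b + t * c) -> a <= b.
Proof.
move=> h; have [c0|c0] := leP c 0.
  by have := h 1; rewrite ltr01 lexx => /(_ isT); lra.
apply/ler_addgt0Pr => e e0.
have t0 : 0 < Num.min (e / c) 1 by rewrite lt_min divr_gt0/=.
have := h (Num.min (e / c) 1); rewrite t0 ge_min lexx orbT => /(_ isT).
have : Num.min (e / c) 1 <= e / c by rewrite ge_min lexx.
rewrite ler_pdivlMr//; lra.
Qed.

Section Subdifferential.
Context {R : realType} {V : euclideanType R}.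
Implicit Types (phi : V -> \bar R) (u v w : V).

Lemma subdifferential_monotone phi u v u' v' :
  subdifferential phi u v -> subdifferential phi u' v' ->
  0 <= inner (v - v') (u - u').
Proof.
move=> [fu /(_ u') vP] [fu' /(_ u) vP']; move: vP vP'.
rewrite -(fineK fu) -(fineK fu') -!EFinD !lee_fin !innerE; lra.
Qed.

Lemma subdifferential_quadratic phi (h : V -> R) (M : 'End(V)) u G d :
  (forall w, -oo < phi w)%E ->
  (forall (x y : V) (t : R), (0 <= t <= 1)%R ->
     (phi (t *: x + (1 - t) *: y)%R <= t%:E * phi x + (1 - t)%:E * phi y)%E) ->
  (forall w, h (u + w) = h u + inner G w + 2^-1 * qform M w) ->
  subdifferential (fun w => phi w + (h w)%:E)%E u d ->
  subdifferential phi u (d - G).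
Proof.
move=> phiNy cphi hE [fu dP].
have {}fu : phi u \is a fin_num by move: fu; rewrite fin_numD => /andP[].
split => // y.
move: (cphi y u) (phiNy y) dP; rewrite -(fineK fu); move: (fine _) => pu.
case Ey : (phi y) => [r| |] // cy _ dP; last by rewrite leey.
rewrite -EFinD lee_fin -lerBrDl.
apply: (@le_of_le_add_scaled _ _ _ (2^-1 * qform M (y - u))) => t /andP[t0 t1].
have := cy t; rewrite (ltW t0) t1 => /(_ isT).
have -> : t *: y + (1 - t) *: u = u + t *: (y - u).
  by rewrite scalerBr scalerBl scale1r addrCA.
rewrite -!EFinM -EFinD.
have := dP (u + t *: (y - u)); have := phiNy (u + t *: (y - u)).
case: (phi _) => [s| |] // _; rewrite ?leey// hE.
rewrite -!EFinD !lee_fin (addrC u) addrK qformZ.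
rewrite !innerZr innerBl => h1 h2; rewrite -(ler_pM2l t0).
set a := inner d _ in h1 *; set b := inner G _ in h1 *.
set q := qform _ _ in h1 *; nra.
Qed.

Lemma subdifferential_closed phi (x v : nat -> V) xl vl :
  (forall w, -oo < phi w)%E -> dom phi !=set0 -> lower_semicontinuous phi ->
  (forall k, subdifferential phi (x k) (v k)) ->
  x @ \oo --> xl -> v @ \oo --> vl -> subdifferential phi xl vl.
Proof.
move=> phiNy [y0 domy0] lsc sub xx vv.
have key y r : phi y = r%:E -> (phi xl <= (r - inner vl (y - xl))%:E)%E.
  move=> yr; rewrite leNgt; apply/negP => lt.
  have [a ra aphi] : exists2 a, r - inner vl (y - xl) < a & (a%:E < phi xl)%E.
    move: lt; case: (phi xl) => [s| |]//.
      by rewrite lte_fin => rs; exists ((r - inner vl (y - xl) + s) / 2);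
        rewrite ?lte_fin; lra.
    by exists (r - inner vl (y - xl) + 1); rewrite ?ltry//; lra.
  have [U Uxl Ua] := lsc _ _ aphi.
  have : r - inner (v k) (y - x k) @[k --> \oo] --> r - inner vl (y - xl).
    apply: cvgB; first exact: cvg_cst.
    by apply: inner_cvg => //; apply: cvgB => //; exact: cvg_cst.
  move=> /cvgr_lt /(_ _ ra) near1; have near2 : \forall k \near \oo, U (x k) := xx _ Uxl.
  have [k [/Ua ak kr]] := filter_ex (filterI near2 near1).
  have [fk /(_ y)] := sub k; rewrite yr -(fineK fk) -EFinD lee_fin => h.
  by move: ak; rewrite -(fineK fk) lte_fin; move: kr h => /=; lra.
have fxl : phi xl \is a fin_num.
  move: domy0 (phiNy y0); rewrite /dom /=.
  case E : (phi y0) => [r| |]// _ _; have := key _ _ E; have := phiNy xl.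
  by case: (phi xl).
split => // y; have := phiNy y; case E : (phi y) => [r| |]// _; last exact: leey.
by have := key _ _ E; rewrite -(fineK fxl) -EFinD !lee_fin; lra.
Qed.

End Subdifferential.

Lemma le_sqrt_mul (R : rcfType) (l a K b : R) : 0 < l -> 0 <= a -> 0 <= K ->
  l * a ^+ 2 <= K * b -> a <= Num.sqrt (K / l) * Num.sqrt b.
Proof.
move=> l0 a0 K0 h; have Kl0 := divr_ge0 K0 (ltW l0).
rewrite -sqrtrM// -(ger0_norm a0) -sqrtr_sqr.
by rewrite ler_wsqrtr// mulrAC ler_pdivlMr// mulrC.
Qed.

Lemma cvg0_of_sqr_le (R : realType) (V : normedModType R) (u : nat -> V) (b : nat -> R)
    (l : R) :
  0 < l -> (forall k, l * `|u k| ^+ 2 <= b k) -> b @ \oo --> 0 -> u @ \oo --> 0.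
Proof.
move=> l0 ub b0; apply/cvgrPdist_lt => d d0.
have ld0 : 0 < l * d ^+ 2 by rewrite mulr_gt0// exprn_gt0.
move/cvgrPdist_lt : b0 => /(_ _ ld0)[N _ Nb]; exists N => // k /Nb /=.
rewrite !sub0r !normrN => bk; have := le_lt_trans (ler_norm _) bk.
by move=> /(le_lt_trans (ub k)); rewrite ltr_pM2l// ltr_pXn2r ?nnegrE// ltW.
Qed.

Lemma summable_addS (R : realType) (e : nat -> R) (C : R) :
  cvgn (series e) -> cvgn (series (fun k => C * (e k + e k.+1))).
Proof.
move=> e_summable.
have : cvgn (series (fun k => e k.+1)).
  rewrite (_ : series _ = (fun n => series e n.+1 - e 0%N)); last first.
    by apply/funext => n; rewrite /series /= big_nat_recl// addrC addKr.
  apply: is_cvgB; last exact: is_cvg_cst.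
  move/cvg_ex : e_summable => [l el]; apply/cvg_ex; exists l.
  by rewrite cvg_shiftS.
by move=> /(is_cvg_seriesD e_summable) /(@is_cvg_seriesZ _ _ C).
Qed.

(** * The inexact two-block majorized proximal ADMM *)

Section QuasiFejer.
Context {R : realType} (P a eta : nat -> R).
Hypothesis P_ge0 : forall k, 0 <= P k.
Hypothesis a_ge0 : forall k, 0 <= a k.
Hypothesis eta_ge0 : forall k, 0 <= eta k.
Hypothesis eta_summable : cvgn (series eta).
Hypothesis P_step : forall k,
  P k.+1 + a k <= P k + eta k * (Num.sqrt (P k.+1) + Num.sqrt (P k)).

(* The difference of squares [P_{k+1} - P_k] factors through
   [sqrt P_{k+1} + sqrt P_k], so each step increases [sqrt P] by at most [eta k]. *)
Lemma quasi_fejer_sqrt k n :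
  Num.sqrt (P (k + n)%N) <= Num.sqrt (P k) + (limn (series eta) - series eta k).
Proof.
have nd : nondecreasing_seq (series eta).
  by apply/nondecreasing_seqP => j; rewrite seriesSr lerDl.
apply: (@le_trans _ _ (Num.sqrt (P k) + (series eta (k + n)%N - series eta k))).
  elim: n => [|n ih]; first by rewrite addn0 subrr addr0.
  rewrite addnS seriesSr; set j := (k + n)%N in ih *.
  suff : Num.sqrt (P j.+1) <= Num.sqrt (P j) + eta j by lra.
  have := P_step j; have := a_ge0 j; have := eta_ge0 j.
  have := sqrtr_ge0 (P j); have := sqrtr_ge0 (P j.+1).
  have := sqr_sqrtr (P_ge0 j); have := sqr_sqrtr (P_ge0 j.+1).
  set s := Num.sqrt (P j); set s' := Num.sqrt (P j.+1) => <- <- s'0 s0 e0 a0 h.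
  by rewrite leNgt; apply/negP => lt; nra.
by rewrite lerD2l lerD2r; exact: nondecreasing_cvgn_le.
Qed.

Lemma quasi_fejer_bounded : exists M, forall k, Num.sqrt (P k) <= M.
Proof.
exists (Num.sqrt (P 0%N) + (limn (series eta) - series eta 0%N)) => k.
by rewrite -[in leLHS](add0n k) quasi_fejer_sqrt.
Qed.

Lemma quasi_fejer_residual : a @ \oo --> 0.
Proof.
have [M PM] := quasi_fejer_bounded.
have nd (u : nat -> R) : (forall k, 0 <= u k) -> nondecreasing_seq (series u).
  by move=> u0; apply/nondecreasing_seqP => j; rewrite seriesSr lerDl.
apply: cvg_series_cvg_0; apply: nondecreasing_is_cvgn; first exact: nd.
exists (P 0%N + 2 * M * limn (series eta)) => _ [n _ <-].
have M0 : 0 <= M by rewrite (le_trans _ (PM 0%N)) ?sqrtr_ge0.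
apply: (@le_trans _ _ (P 0%N + 2 * M * series eta n)); last first.
  rewrite lerD2l ler_wpM2l ?mulr_ge0//; apply: nondecreasing_cvgn_le => //.
  exact: nd.
suff : P n + series a n <= P 0%N + 2 * M * series eta n by have := P_ge0 n; lra.
elim: n => [|n ih]; first by rewrite /series /= !big_geq// mulr0.
rewrite !seriesSr.
have : eta n * (Num.sqrt (P n.+1) + Num.sqrt (P n)) <= eta n * (2 * M).
  by rewrite ler_wpM2l//; have := PM n; have := PM n.+1; lra.
by have := P_step n; lra.
Qed.

Lemma quasi_fejer_cvg0 :
  (forall e N, 0 < e -> exists2 k, (N <= k)%N & P k < e) -> P @ \oo --> 0.
Proof.
move=> clus; apply/cvgrPdist_lt => e e0.
pose d := Num.sqrt e / 2.
have se0 : 0 < Num.sqrt e by rewrite sqrtr_gt0.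
have d0 : 0 < d by rewrite divr_gt0.
move/cvgrPdist_lt : eta_summable => /(_ d d0)[N _ NP].
have [k Nk kd] := clus (d ^+ 2) N (exprn_gt0 _ d0).
exists k => // j /= kj; rewrite sub0r normrN ger0_norm//.
have := quasi_fejer_sqrt k (j - k); rewrite subnKC// => h.
have h2 := NP _ Nk; rewrite /= in h2.
have := sqr_sqrtr (P_ge0 k); have := sqr_sqrtr (P_ge0 j).
have := sqr_sqrtr (ltW e0); have := sqrtr_ge0 (P k); have := sqrtr_ge0 (P j).
have [_ h2'] := ltr_normlP _ _ h2; move: h h2' kd; rewrite /d.
move: (Num.sqrt e) (Num.sqrt (P j)) (Num.sqrt (P k)) se0 => se sj sk se0.
move=> h1 h3 h4 sj0 sk0 <- <- E; rewrite -E in h4.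
have skse : sk < se / 2 by rewrite ltNge; apply/negP => lt; nra.
have sjse : sj < se by lra.
by rewrite ltr_pXn2r ?nnegrE// ltW.
Qed.

End QuasiFejer.

Section StepLength.
Context {R : realType}.

Lemma golden_ratio_pos (tau : R) : 0 < tau < (1 + Num.sqrt 5) / 2 ->
  0 < 1 + tau - tau ^+ 2.
Proof.
move=> /andP[t0 t5]; have := sqr_sqrtr (ler0n R 5); have := sqrtr_ge0 (5 : R).
move: (Num.sqrt 5) t5 => s t5 s0 s5.
have [t1|t1] := leP tau 2^-1; first by nra.
have : 0 < (s - (2 * tau - 1)) * (s + (2 * tau - 1)) by rewrite mulr_gt0//; lra.
by nra.
Qed.

(* Young's inequality with weight [Num.max 1 tau]; for [tau >= 1] it leaves the
   coefficient [1 + tau - tau^2] in front of [|b|^2], whence the golden ratio. *)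
Lemma step_length_young (tau : R) : 0 < tau < (1 + Num.sqrt 5) / 2 ->
  exists al ka : R, [/\ 0 < al, 0 < ka & forall (Z : euclideanType R) (b r r' : Z),
   ka * (`|r'| ^+ 2 - `|r| ^+ 2) + al * (`|r'| ^+ 2 + `|b| ^+ 2) <=
   `|b| ^+ 2 - 2 * (1 - tau) * inner b r + (2 - tau) * `|r'| ^+ 2].
Proof.
move=> tP; have g0 := golden_ratio_pos tP; have /andP[t0 _] := tP.
have [t1|t1] := leP tau 1.
  exists (Num.min tau 2^-1), (1 - tau + 2^-1).
  split=> [||Z b r r']; [by rewrite lt_min t0 invr_gt0/=|lra|].
  have al1 : Num.min tau 2^-1 <= tau by rewrite ge_min lexx.
  have al2 : Num.min tau 2^-1 <= 2^-1 by rewrite ge_min lexx orbT.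
  have := inner_ge0 (b - r); have := inner_ge0 b; have := inner_ge0 r.
  have := inner_ge0 r'; rewrite -!inner_norm !innerE (innerC r b).
  move: (Num.min _ _) (inner r' r') (inner r r) (inner b b) (inner b r) al1 al2.
  by move=> al r2' r2 b2 br; nra.
pose de := (1 + tau - tau ^+ 2) / tau.
have de0 : 0 < de by rewrite divr_gt0.
exists (Num.min (1 + tau - tau ^+ 2) (de / 2)), ((tau - 1) / tau + de / 2).
split=> [||Z b r r'].
- by rewrite lt_min g0 divr_gt0.
- by rewrite addr_gt0// divr_gt0// subr_gt0.
set al := Num.min _ _.
have al1 : al <= 1 + tau - tau ^+ 2 by rewrite ge_min lexx.
have al2 : al <= de / 2 by rewrite ge_min lexx orbT.
have := inner_ge0 (tau *: b + r); have := inner_ge0 b; have := inner_ge0 r.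
have := inner_ge0 r'; rewrite -!inner_norm !innerE (innerC r b).
have deE : 2 - tau = (tau - 1) / tau + de by rewrite /de; field; rewrite gt_eqF.
rewrite deE.
move: al (inner r' r') (inner r r) (inner b b) (inner b r) al1 al2.
move=> al r2' r2 b2 br al1 al2 r2'0 r20 b20 h.
have h' : 0 <= (tau - 1) / tau * (tau * (tau * b2) + tau * br + (tau * br + r2)).
  rewrite mulr_ge0 ?divr_ge0//; lra.
have E : (tau - 1) / tau * (tau * (tau * b2) + tau * br + (tau * br + r2)) =
  (tau - 1) * tau * b2 + 2 * (tau - 1) * br + (tau - 1) / tau * r2.
  by field; rewrite gt_eqF.
rewrite E in h'; move: ((tau - 1) / tau) h' => k h'.
have : al * b2 <= (1 + tau - tau ^+ 2) * b2 by rewrite ler_wpM2r.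
have : al * r2' <= de / 2 * r2' by rewrite ler_wpM2r.
have : 0 <= de * r2 by rewrite mulr_ge0// ltW.
lra.
Qed.

End StepLength.

Section TwoBlock.
Context {R : realType} {V W Z : euclideanType R}.
Variables (p : V -> \bar R) (q : W -> \bar R) (Gf : V -> V) (Gg : W -> W).
Variables (A : 'Hom(Z, V)) (B : 'Hom(Z, W)) (At : 'Hom(V, Z)) (Bt : 'Hom(W, Z)).
Variables (c : Z) (sigma tau : R) (Sf S : 'End(V)) (Sg T : 'End(W)).
Hypothesis AtP : forall z v, inner (A z) v = inner z (At v).
Hypothesis BtP : forall z v, inner (B z) v = inner z (Bt v).
Hypothesis coGf : forall x y z,
  - (4^-1 * qform Sf (z - x)) <= inner (Gf x - Gf y) (z - y).
Hypothesis coGg : forall x y z,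
  - (4^-1 * qform Sg (z - x)) <= inner (Gg x - Gg y) (z - y).
Hypothesis saSf : self_adjoint Sf.
Hypothesis saS : self_adjoint S.
Hypothesis saSg : self_adjoint Sg.
Hypothesis saT : self_adjoint T.
Hypothesis psdT : forall u, 0 <= 2^-1 * qform Sg u + qform T u.
Hypothesis sigma_gt0 : 0 < sigma.
Hypothesis tau_gt0 : 0 < tau.

Local Notation Hx := (Sf + S).
Local Notation Hy := (Sg + T).
Local Notation res x y := (At x + Bt y - c).

Definition xoptimal x x' y z d := subdifferential p x'
  (d - Gf x - A z - sigma *: A (At x' + Bt y - c) - Hx (x' - x)).

Definition yoptimal x' y y' z d := subdifferential q y'
  (d - Gg y - B z - sigma *: B (At x' + Bt y' - c) - Hy (y' - y)).

Definition kkt x y z := [/\ subdifferential p x (- Gf x - A z),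
  subdifferential q y (- Gg y - B z) & At x + Bt y = c].

Definition merit (xb : V) (yb : W) (zb : Z) x y z : R := `|z - zb| ^+ 2 / (tau * sigma)
  + qform Hx (x - xb) + qform Hy (y - yb) + sigma * `|Bt (y - yb)| ^+ 2.

Lemma two_block_descent xb yb zb x x' y y' z dx dy :
  kkt xb yb zb -> xoptimal x x' y z dx -> yoptimal x' y y' z dy ->
  let r := res x' y' in
  merit xb yb zb x' y' (z + (tau * sigma) *: r)
    + (2^-1 * qform Sf (x' - x) + qform S (x' - x))
    + (2^-1 * qform Sg (y' - y) + qform T (y' - y))
    + sigma * (`|Bt (y' - y)| ^+ 2 - 2 * inner (Bt (y' - y)) r
               + (2 - tau) * `|r| ^+ 2)
  <= merit xb yb zb x y z + 2 * inner dx (x' - xb) + 2 * inner dy (y' - yb).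
Proof.
move=> [kx ky kc] ox oy /=.
have := subdifferential_monotone ox kx; have := subdifferential_monotone oy ky.
have := coGf x xb x'; have := coGg y yb y'.
rewrite /merit -kc.
have -> : x' - x = (x' - xb) - (x - xb) by rewrite opprB addrA subrK.
have -> : y' - y = (y' - yb) - (y - yb) by rewrite opprB addrA subrK.
have -> : At x' + Bt y' - (At xb + Bt yb) = At (x' - xb) + Bt (y' - yb).
  by rewrite !linearB /= opprD addrACA.
have -> : At x' + Bt y - (At xb + Bt yb) = At (x' - xb) + Bt (y - yb).
  by rewrite !linearB /= opprD addrACA.
have -> : z + (tau * sigma) *: (At (x' - xb) + Bt (y' - yb)) - zb =
   (z - zb) + (tau * sigma) *: (At (x' - xb) + Bt (y' - yb)) by rewrite addrAC.
move: (x' - xb) (x - xb) (y' - yb) (y - yb) (Gf x) (Gf xb) (Gg y) (Gg yb).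
move=> X' X Y' Y gx gxb gy gyb c2 c1.
have polX := qform_polarization X X' (H := Hx).
have polY := qform_polarization Y Y' (H := Hy).
have saHx : self_adjoint Hx by exact: self_adjointD.
have saHy : self_adjoint Hy by exact: self_adjointD.
move: {polX polY} (polX saHx) (polY saHy); rewrite !(qformDl _ _ (_ - _)).
have -> (g : W) : inner (dy - g - B z - sigma *: B (At X' + Bt Y') - Hy (Y' - Y)
    - (- gyb - B zb)) Y' = inner dy Y' - inner (g - gyb) Y' - inner (z - zb) (Bt Y')
    - sigma * inner (At X' + Bt Y') (Bt Y') - inner (Hy (Y' - Y)) Y'.
  by rewrite !innerE !BtP !innerE; ring.
have -> (g : V) : inner (dx - g - A z - sigma *: A (At X' + Bt Y) - Hx (X' - X)
    - (- gxb - A zb)) X' = inner dx X' - inner (g - gxb) X' - inner (z - zb) (At X')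
    - sigma * inner (At X' + Bt Y) (At X') - inner (Hx (X' - X)) X'.
  by rewrite !innerE !AtP !innerE; ring.
rewrite (linearB Bt) /= -!inner_norm.
move: (z - zb) (At X') (Bt Y') (Bt Y) => ze a b' b.
have ts0 : tau * sigma != 0 by rewrite mulf_neq0// gt_eqF.
have -> (u v : Z) : inner (u + (tau * sigma) *: v) (u + (tau * sigma) *: v)
    / (tau * sigma)
    = inner u u / (tau * sigma) + 2 * inner u v + tau * sigma * inner v v.
  by rewrite !innerE (innerC v u); field; rewrite !gt_eqF.
rewrite !innerE in c1 c2 *.
rewrite ?(innerC b' a) ?(innerC b a) ?(innerC b' b) ?(innerC b' ze) ?(innerC a ze).
lra.
Qed.

(* Monotonicity of [dq] between two consecutive y-steps trades [<Bt Dy, r'>] for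
   [<Bt Dy, r>], which is what makes step lengths beyond [1] possible. *)
Lemma two_block_cross x x' y1 y y' z1 dy1 dy :
  yoptimal x y1 y z1 dy1 ->
  let r := res x y in let r' := res x' y' in
  yoptimal x' y y' (z1 + (tau * sigma) *: r) dy ->
  2 * sigma * (1 - tau) * inner (Bt (y' - y)) r
    + qform Hy (y - y1) + 2 * inner (dy - dy1) (y' - y) >=
  2 * sigma * inner (Bt (y' - y)) r' + qform Hy (y' - y).
Proof.
move=> o1 r r' o2; have := subdifferential_monotone o2 o1.
have := coGg y y1 (y1 + (y' - y)); rewrite -/r -/r'; move: r r' {o1 o2} => r r'.
have -> : y1 + (y' - y) - y1 = y' - y by rewrite addrC addKr.
have -> : y1 + (y' - y) - y = (y' - y) - (y - y1)
  by rewrite -addrA opprB [RHS]addrCA.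
move: (y' - y) (y - y1) (Gg y) (Gg y1) => D E g g1.
have saHy : self_adjoint Hy by exact: self_adjointD.
have := psdT (D - E); have := qformB D E saHy.
rewrite !(qformDl _ _ (_ - _)).
have -> : inner (dy - g - B (z1 + (tau * sigma) *: r) - sigma *: B r' - Hy D
    - (dy1 - g1 - B z1 - sigma *: B r - Hy E)) D =
    inner (dy - dy1) D - inner (g - g1) D - sigma * inner (Bt D) r'
    + sigma * (1 - tau) * inner (Bt D) r - (qform Hy D - inner D (Hy E)).
  rewrite /qform (innerC D (Hy D)) (innerC D (Hy E)) !innerE !BtP !innerE.
  by rewrite (innerC r) (innerC r'); ring.
lra.
Qed.

Hypothesis psdSf : psd Sf.
Hypothesis psdSg : psd Sg.
Hypothesis psdS : forall u, 0 <= 2^-1 * qform Sf u + qform S u.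
Variables (lx ly al ka : R).
Hypothesis lx_gt0 : 0 < lx.
Hypothesis ly_gt0 : 0 < ly.
Hypothesis coercive_x : forall u,
  lx * `|u| ^+ 2 <= 2^-1 * qform Sf u + qform S u + sigma * `|At u| ^+ 2.
Hypothesis coercive_y : forall u,
  ly * `|u| ^+ 2 <= 2^-1 * qform Sg u + qform T u + sigma * `|Bt u| ^+ 2.
Hypothesis al_gt0 : 0 < al.
Hypothesis ka_gt0 : 0 < ka.
Hypothesis young : forall b r r' : Z,
   ka * (`|r'| ^+ 2 - `|r| ^+ 2) + al * (`|r'| ^+ 2 + `|b| ^+ 2) <=
   `|b| ^+ 2 - 2 * (1 - tau) * inner b r + (2 - tau) * `|r'| ^+ 2.
Variables (x : nat -> V) (y : nat -> W) (z : nat -> Z).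
Variables (dx : nat -> V) (dy : nat -> W) (e : nat -> R).
Hypothesis xopt : forall k, xoptimal (x k) (x k.+1) (y k) (z k) (dx k).
Hypothesis yopt : forall k, yoptimal (x k.+1) (y k) (y k.+1) (z k) (dy k).
Hypothesis zupd : forall k,
  z k.+1 = z k + (tau * sigma) *: res (x k.+1) (y k.+1).
Hypothesis dxe : forall k, `|dx k| <= e k.
Hypothesis dye : forall k, `|dy k| <= e k.
Hypothesis e_summable : cvgn (series e).

(* The [ka]-term makes the potential control [At (x - xb)], which [merit] does
   not see; the last term telescopes the lagged term of [two_block_cross]. *)
Definition potential xb yb zb k : R :=
  merit xb yb zb (x k.+1) (y k.+1) (z k.+1)
  + sigma * ka * `|res (x k.+1) (y k.+1)| ^+ 2 + qform Hy (y k.+1 - y k).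

Definition residual k : R :=
  (2^-1 * qform Sf (x k.+2 - x k.+1) + qform S (x k.+2 - x k.+1))
  + (2^-1 * qform Sg (y k.+2 - y k.+1) + qform T (y k.+2 - y k.+1))
  + sigma * al * (`|res (x k.+2) (y k.+2)| ^+ 2 + `|Bt (y k.+2 - y k.+1)| ^+ 2).

Lemma potential_descent xb yb zb k : kkt xb yb zb ->
  potential xb yb zb k.+1 + residual k <= potential xb yb zb k
    + 2 * inner (dx k.+1) (x k.+2 - xb) + 2 * inner (dy k.+1) (y k.+2 - yb)
    + 2 * inner (dy k.+1 - dy k) (y k.+2 - y k.+1).
Proof.
move=> kb.
have := yopt k.+1; rewrite zupd => /(two_block_cross (yopt k)).
have := two_block_descent kb (xopt k.+1) (yopt k.+1); rewrite /= -zupd.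
have := ler_wpM2l (ltW sigma_gt0) (young (Bt (y k.+2 - y k.+1))
  (res (x k.+1) (y k.+1)) (res (x k.+2) (y k.+2))).
rewrite /potential /residual; lra.
Qed.

Lemma qformHx_ge0 u : 0 <= qform Hx u.
Proof. by rewrite qformDl; have := psdS u; have := psdSf u; lra. Qed.

Lemma qformHy_ge0 u : 0 <= qform Hy u.
Proof. by rewrite qformDl; have := psdT u; have := psdSg u; lra. Qed.

Lemma residual_ge0 k : 0 <= residual k.
Proof.
rewrite addr_ge0//; first by rewrite addr_ge0.
by rewrite mulr_ge0 ?addr_ge0 ?sqr_ge0// mulr_ge0// ltW.
Qed.

Lemma potential_coercive xb yb zb k : At xb + Bt yb = c ->
  let P := potential xb yb zb k in
  [/\ 0 <= P, lx * `|x k.+1 - xb| ^+ 2 <= (3 + 2 / ka) * P,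
      ly * `|y k.+1 - yb| ^+ 2 <= P & `|z k.+1 - zb| ^+ 2 <= tau * sigma * P].
Proof.
move=> kc; rewrite /potential /merit.
have ts0 : 0 < tau * sigma by rewrite mulr_gt0.
have : 0 <= `|z k.+1 - zb| ^+ 2 / (tau * sigma).
  by rewrite mulr_ge0 ?sqr_ge0// invr_ge0 ltW.
have zE : tau * sigma * (`|z k.+1 - zb| ^+ 2 / (tau * sigma)) = `|z k.+1 - zb| ^+ 2.
  by rewrite mulrC divfK// gt_eqF.
have := qformHy_ge0 (y k.+1 - yb); have := qformHx_ge0 (x k.+1 - xb).
have := qformHy_ge0 (y k.+1 - y k).
have : 0 <= sigma * ka * `|res (x k.+1) (y k.+1)| ^+ 2.
  by rewrite mulr_ge0 ?sqr_ge0// mulr_ge0 ?ltW.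
have : 0 <= sigma * `|Bt (y k.+1 - yb)| ^+ 2.
  by rewrite mulr_ge0 ?sqr_ge0// ltW.
have := coercive_x (x k.+1 - xb); have := coercive_y (y k.+1 - yb).
have := psdSf (x k.+1 - xb); have := psdSg (y k.+1 - yb).
have : sigma * `|At (x k.+1 - xb)| ^+ 2 <=
  2 / ka * (sigma * ka * `|res (x k.+1) (y k.+1)| ^+ 2)
  + 2 * (sigma * `|Bt (y k.+1 - yb)| ^+ 2).
  have -> : At (x k.+1 - xb) = res (x k.+1) (y k.+1) - Bt (y k.+1 - yb).
    rewrite (_ : res _ _ = At (x k.+1 - xb) + Bt (y k.+1 - yb)) ?addrK//.
    by rewrite -kc !linearB /= opprD addrACA.
  have -> : 2 / ka * (sigma * ka * `|res (x k.+1) (y k.+1)| ^+ 2) =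
    sigma * (2 * `|res (x k.+1) (y k.+1)| ^+ 2) by field; rewrite gt_eqF.
  by rewrite (mulrCA 2 sigma) -mulrDr ler_wpM2l ?sqr_normB_le// ltW.
have k0 : 0 <= 2 / ka by rewrite divr_ge0// ltW.
rewrite !(qformDl Sf) !(qformDl Sg).
move=> h1 h2 h3 h4 h5 h6 h7 h8 h9 h10 h11.
split; first by lra.
- rewrite mulrDl; set P := (X in 3 * X).
  suff : 2 / ka * (sigma * ka * `|res (x k.+1) (y k.+1)| ^+ 2) <= 2 / ka * P.
    by rewrite /P; lra.
  by rewrite ler_wpM2l// /P; lra.
- lra.
- rewrite -[leLHS]zE ler_pM2l//; lra.
Qed.

Lemma potential_norm xb yb zb : At xb + Bt yb = c ->
  exists2 C, 0 < C & forall k, let s := Num.sqrt (potential xb yb zb k) in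
  [/\ `|x k.+1 - xb| <= C * s, `|y k.+1 - yb| <= C * s & `|z k.+1 - zb| <= C * s].
Proof.
move=> kc.
exists (1 + Num.sqrt ((3 + 2 / ka) / lx) + Num.sqrt (1 / ly)
  + Num.sqrt (tau * sigma / 1)).
  by have := sqrtr_ge0 ((3 + 2 / ka) / lx); have := sqrtr_ge0 (1 / ly);
    have := sqrtr_ge0 (tau * sigma / 1); lra.
move=> k /=; have [P0 Px Py Pz] := potential_coercive zb k kc.
have ts0 : 0 < tau * sigma by rewrite mulr_gt0.
have K0 : 0 <= 3 + 2 / ka by rewrite addr_ge0// divr_ge0// ltW.
rewrite -[leRHS]mul1r in Py; rewrite -[leLHS]mul1r in Pz.
have hx := le_sqrt_mul lx_gt0 (normr_ge0 _) K0 Px.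
have hy := le_sqrt_mul ly_gt0 (normr_ge0 _) ler01 Py.
have hz := le_sqrt_mul ltr01 (normr_ge0 _) (ltW ts0) Pz.
move: hx hy hz (sqrtr_ge0 (potential xb yb zb k)) (sqrtr_ge0 ((3 + 2 / ka) / lx))
  (sqrtr_ge0 (1 / ly)) (sqrtr_ge0 (tau * sigma / 1)).
move: (Num.sqrt (potential _ _ _ _)) (Num.sqrt (_ / lx)) (Num.sqrt (1 / ly))
  (Num.sqrt (_ / 1)) => t a1 a2 a3 hx hy hz t0 a10 a20 a30.
have := mulr_ge0 a10 t0; have := mulr_ge0 a20 t0; have := mulr_ge0 a30 t0.
by rewrite !mulrDl mul1r; split; lra.
Qed.

Lemma e_ge0 k : 0 <= e k.
Proof. exact: le_trans (normr_ge0 _) (dxe k). Qed.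

Lemma potential_step xb yb zb : kkt xb yb zb ->
  exists2 C, 0 < C & forall k,
  potential xb yb zb k.+1 + residual k <= potential xb yb zb k + C * (e k + e k.+1)
    * (Num.sqrt (potential xb yb zb k.+1) + Num.sqrt (potential xb yb zb k)).
Proof.
move=> kb; have [_ _ kc] := kb; have [C C0 CP] := potential_norm zb kc.
exists (6 * C); first by rewrite mulr_gt0.
move=> k; have := potential_descent k kb.
have [Xk Yk _] := CP k; have [Xk1 Yk1 _] := CP k.+1; rewrite /= in Xk Yk Xk1 Yk1.
set s' := Num.sqrt (potential xb yb zb k.+1) in Xk1 Yk1 *.
set s := Num.sqrt (potential xb yb zb k) in Xk Yk *.
have s0 : 0 <= s by exact: sqrtr_ge0.
have s'0 : 0 <= s' by exact: sqrtr_ge0.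
have bound (U : euclideanType R) (d u : U) E M : `|d| <= E -> `|u| <= M ->
    inner d u <= E * M.
  by move=> dE uM; rewrite (le_trans (inner_le_norm _ _))// ler_pM.
have b1 := bound _ _ _ _ _ (dxe k.+1) Xk1.
have b2 := bound _ _ _ _ _ (dye k.+1) Yk1.
have b3 : inner (dy k.+1 - dy k) (y k.+2 - y k.+1)
    <= (e k + e k.+1) * (C * s' + C * s).
  apply: bound.
    by rewrite [leRHS]addrC (le_trans (ler_normB _ _))// lerD.
  by rewrite -(subrKA yb) (le_trans (ler_normD _ _))// lerD// distrC.
have ek := mulr_ge0 (e_ge0 k) (mulr_ge0 (ltW C0) s'0).
have ek1 := mulr_ge0 (e_ge0 k.+1) (mulr_ge0 (ltW C0) s0).
have ek2 := mulr_ge0 (e_ge0 k) (mulr_ge0 (ltW C0) s0).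
have ek3 := mulr_ge0 (e_ge0 k.+1) (mulr_ge0 (ltW C0) s'0).
move: b1 b2 b3; move: (inner _ _) (inner _ _) (inner _ _) => i1 i2 i3 b1 b2 b3.
lra.
Qed.

Hypothesis cGf : continuous Gf.
Hypothesis cGg : continuous Gg.
Hypothesis p_gtNy : forall u, (-oo < p u)%E.
Hypothesis q_gtNy : forall u, (-oo < q u)%E.
Hypothesis p_dom : dom p !=set0.
Hypothesis q_dom : dom q !=set0.
Hypothesis p_lsc : lower_semicontinuous p.
Hypothesis q_lsc : lower_semicontinuous q.

Lemma two_block_convergence : (exists xb yb zb, kkt xb yb zb) ->
  exists xs ys zs, kkt xs ys zs /\
    [/\ x @ \oo --> xs, y @ \oo --> ys & z @ \oo --> zs].
Proof.
move=> [xb [yb [zb kb]]].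
have P_ge0 xs ys zs : kkt xs ys zs -> forall k, 0 <= potential xs ys zs k.
  by move=> [_ _ kc] k; have [] := potential_coercive zs k kc.
have [C C0 Pstep] := potential_step kb.
have eta0 (D : R) k : 0 < D -> 0 <= D * (e k + e k.+1).
  by move=> D0; rewrite mulr_ge0 ?addr_ge0 ?e_ge0// ltW.
have eta0C k := eta0 C k C0.
have res0 := quasi_fejer_residual (P_ge0 _ _ _ kb) residual_ge0 eta0C
  (@summable_addS _ _ C e_summable) Pstep.
have [M PM] := quasi_fejer_bounded (P_ge0 _ _ _ kb) residual_ge0 eta0C
  (@summable_addS _ _ C e_summable) Pstep.
have e0 : e @ \oo --> 0 by exact: cvg_series_cvg_0.
have dx0 : dx @ \oo --> 0.
  apply/norm_cvg0P; apply: (@squeeze_cvgr _ _ _ _ (cst 0) e) => //.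
    by near=> k; rewrite normr_ge0 dxe.
  exact: cvg_cst.
have dy0 : dy @ \oo --> 0.
  apply/norm_cvg0P; apply: (@squeeze_cvgr _ _ _ _ (cst 0) e) => //.
    by near=> k; rewrite normr_ge0 dye.
  exact: cvg_cst.
have sal0 : 0 < sigma * al by rewrite mulr_gt0.
have ge0r k : 0 <= sigma * al * `|res (x k.+2) (y k.+2)| ^+ 2.
  by rewrite mulr_ge0 ?sqr_ge0// ltW.
have ge0b k : 0 <= sigma * al * `|Bt (y k.+2 - y k.+1)| ^+ 2.
  by rewrite mulr_ge0 ?sqr_ge0// ltW.
have r2 : res (x k.+2) (y k.+2) @[k --> \oo] --> 0.
  apply: (cvg0_of_sqr_le sal0 _ res0) => k; rewrite /residual.
  have := psdS (x k.+2 - x k.+1); have := psdT (y k.+2 - y k.+1).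
  by have := ge0r k; have := ge0b k; lra.
have r1 : res (x k.+1) (y k.+1) @[k --> \oo] --> 0.
  by rewrite -(cvg_shiftS (fun k => res (x k.+1) (y k.+1))).
have bD : Bt (y k.+2 - y k.+1) @[k --> \oo] --> 0.
  apply: (cvg0_of_sqr_le sal0 _ res0) => k; rewrite /residual.
  have := psdS (x k.+2 - x k.+1); have := psdT (y k.+2 - y k.+1).
  by have := ge0r k; have := ge0b k; lra.
have aD : At (x k.+2 - x k.+1) @[k --> \oo] --> 0.
  rewrite (_ : (fun k => _) = (fun k => res (x k.+2) (y k.+2)
      - res (x k.+1) (y k.+1) - Bt (y k.+2 - y k.+1))); last first.
    apply/funext => k; rewrite [Bt (_ - _)]linearB [At (_ - _)]linearB /=.
    rewrite [X in _ = X - _](_ : _ = At (x k.+2) - At (x k.+1)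
      + (Bt (y k.+2) - Bt (y k.+1))) ?addrK//.
    by rewrite opprB addrA subrK opprD addrACA.
  by rewrite -(subr0 0) -{1}(subr0 0); apply: cvgB => //; apply: cvgB.
have mul0 (u : nat -> R) (D : R) :
    u @ \oo --> 0 -> D * u k @[k --> \oo] --> 0.
  by move=> u0; rewrite -[X in _ --> X](mulr0 D); apply: cvgM => //; exact: cvg_cst.
have xD : x k.+2 - x k.+1 @[k --> \oo] --> 0.
  apply: (@cvg0_of_sqr_le _ _ _
    (fun k => residual k + sigma * `|At (x k.+2 - x k.+1)| ^+ 2) lx) => //.
    move=> k; have := coercive_x (x k.+2 - x k.+1); rewrite /residual.
    by have := psdT (y k.+2 - y k.+1); have := ge0r k; have := ge0b k; lra.
  by rewrite -(addr0 0); apply: cvgD => //; apply: mul0; exact: sqr_norm_cvg0.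
have yD : y k.+2 - y k.+1 @[k --> \oo] --> 0.
  apply: (@cvg0_of_sqr_le _ _ _
    (fun k => residual k + sigma * `|Bt (y k.+2 - y k.+1)| ^+ 2) ly) => //.
    move=> k; have := coercive_y (y k.+2 - y k.+1); rewrite /residual.
    by have := psdS (x k.+2 - x k.+1); have := ge0r k; have := ge0b k; lra.
  by rewrite -(addr0 0); apply: cvgD => //; apply: mul0; exact: sqr_norm_cvg0.
have [_ _ kc] := kb; have [C' C'0 CP] := potential_norm zb kc.
have bnd (U : euclideanType R) (u : nat -> U) (ub : U) :
    (forall k, `|u k.+1 - ub| <= C' * Num.sqrt (potential xb yb zb k)) ->
    forall k, `|u k.+1| <= C' * M + `|ub|.
  move=> h k; rewrite -{1}(subrK ub (u k.+1)) (le_trans (ler_normD _ _))//.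
  by rewrite lerD2r (le_trans (h k))// ler_wpM2l// ltW.
have [|h1 h1i /cvg_ex[xl xc]] := @bounded_subsequence _ _ (fun k => x k.+1)
  (C' * M + `|xb|); first by apply: bnd => k; have [] := CP k.
have [|h2 h2i /cvg_ex[yl yc]] := @bounded_subsequence _ _ (fun k => y (h1 k).+1)
  (C' * M + `|yb|); first by move=> k; apply: bnd => j; have [] := CP j.
have [|h3 h3i /cvg_ex[zl zc]] := @bounded_subsequence _ _
  (fun k => z (h1 (h2 k)).+1)
  (C' * M + `|zb|); first by move=> k; apply: bnd => j; have [] := CP j.
pose h k := h1 (h2 (h3 k)).
have hoo : h @ \oo --> \oo.
  apply: cvg_comp (increasing_seq_cvg_oo h1i).
  by apply: cvg_comp (increasing_seq_cvg_oo h2i); exact: increasing_seq_cvg_oo.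
have {}xc : x (h k).+1 @[k --> \oo] --> xl.
  apply: cvg_comp xc.
  by apply: cvg_comp (increasing_seq_cvg_oo h2i); exact: increasing_seq_cvg_oo.
have {}yc : y (h k).+1 @[k --> \oo] --> yl.
  by apply: cvg_comp yc; exact: increasing_seq_cvg_oo.
have {}zc : z (h k).+1 @[k --> \oo] --> zl by exact: zc.
have sub (U : euclideanType R) (u : nat -> U) (l : U) :
  u @ \oo --> l -> u (h k) @[k --> \oo] --> l by move=> ul; exact: cvg_comp hoo ul.
have rl0 : At xl + Bt yl - c = 0.
  have r1h : res (x (h k).+1) (y (h k).+1) @[k --> \oo] --> 0 := sub _ _ _ r1.
  rewrite -(cvg_lim (@norm_hausdorff _ _) r1h); apply/esym/cvg_lim => //.
  apply: cvgB; last exact: cvg_cst.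
  by apply: cvgD; exact: hom_cvg.
have xc2 : x (h k).+2 @[k --> \oo] --> xl.
  rewrite (_ : (fun k => _) = (fun k => x (h k).+2 - x (h k).+1 + x (h k).+1)).
    by rewrite -[xl]add0r; apply: cvgD => //; exact: sub _ _ _ xD.
  by apply/funext => k; rewrite subrK.
have yc2 : y (h k).+2 @[k --> \oo] --> yl.
  rewrite (_ : (fun k => _) = (fun k => y (h k).+2 - y (h k).+1 + y (h k).+1)).
    by rewrite -[yl]add0r; apply: cvgD => //; exact: sub _ _ _ yD.
  by apply/funext => k; rewrite subrK.
have kl : kkt xl yl zl.
  split; last exact: subr0_eq.
  - apply: (subdifferential_closed p_gtNy p_dom p_lsc
      (fun k => xopt (h k).+1) xc2).
    have -> : - Gf xl - A zl = 0 - Gf xl - A zl - sigma *: A 0 - Hx 0.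
      by rewrite !linear0 !addr0 sub0r.
    apply: cvgB; last by apply: hom_cvg; exact: sub _ _ _ xD.
    apply: cvgB.
      apply: cvgB; last exact: hom_cvg.
      apply: cvgB; last by apply: continuous_cvg => //; exact: cGf.
      apply: (sub _ (fun k => dx k.+1)).
      by rewrite (cvg_shiftS dx).
    apply: cvgZl_tmp; apply: hom_cvg; rewrite -rl0.
    apply: cvgB; last exact: cvg_cst.
    by apply: cvgD; exact: hom_cvg.
  - apply: (subdifferential_closed q_gtNy q_dom q_lsc
      (fun k => yopt (h k).+1) yc2).
    have -> : - Gg yl - B zl = 0 - Gg yl - B zl - sigma *: B 0 - Hy 0.
      by rewrite !linear0 !addr0 sub0r.
    apply: cvgB; last by apply: hom_cvg; exact: sub _ _ _ yD.
    apply: cvgB.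
      apply: cvgB; last exact: hom_cvg.
      apply: cvgB; last by apply: continuous_cvg => //; exact: cGg.
      apply: (sub _ (fun k => dy k.+1)).
      by rewrite (cvg_shiftS dy).
    by apply: cvgZl_tmp; apply: hom_cvg; exact: sub _ _ _ r2.
have diff0 (U : euclideanType R) (u : nat -> U) (l : U) :
    u @ \oo --> l -> u k - l @[k --> \oo] --> 0.
  by move=> ul; rewrite -(subrr l); apply: cvgB => //; exact: cvg_cst.
have add00 (u v : nat -> R) :
    u @ \oo --> 0 -> v @ \oo --> 0 -> u k + v k @[k --> \oo] --> 0.
  by move=> u0 v0; rewrite -(addr0 0); exact: cvgD.
have Ph : potential xl yl zl (h k) @[k --> \oo] --> 0.
  do 5 ?[apply: (add00)].
  - under eq_fun do rewrite mulrC.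
    by apply: mul0; apply: sqr_norm_cvg0; exact: diff0.
  - by apply: qform_cvg0; exact: diff0.
  - by apply: qform_cvg0; exact: diff0.
  - by apply: mul0; apply: sqr_norm_cvg0; rewrite -(linear0 Bt);
      apply: hom_cvg; exact: diff0.
  - by apply: mul0; apply: sqr_norm_cvg0; exact: sub _ _ _ r1.
  - apply: qform_cvg0; apply: (sub _ (fun k => y k.+1 - y k)).
    by rewrite -(cvg_shiftS (fun k => y k.+1 - y k)).
have [D D0 Dstep] := potential_step kl.
have P0 : potential xl yl zl @ \oo --> 0.
  apply: (quasi_fejer_cvg0 (P_ge0 _ _ _ kl) residual_ge0
    (fun k => eta0 D k D0) (@summable_addS _ _ D e_summable) Dstep) => d N d0.
  have Nh : \forall k \near \oo, (N <= h k)%N.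
    by apply: (hoo [set k | (N <= k)%N]); exists N.
  move/cvgrPdist_lt : Ph => /(_ d d0) Pd.
  have [k [Nk Pk]] := filter_ex (filterI Nh Pd); exists (h k) => //.
  by move: Pk; rewrite sub0r normrN => /(le_lt_trans (ler_norm _)).
have [_ _ kcl] := kl.
exists xl, yl, zl; split=> //.
have fin (U : euclideanType R) (u : nat -> U) (ul : U) (l K : R) : 0 < l ->
    (forall k, l * `|u k.+1 - ul| ^+ 2 <= K * potential xl yl zl k) ->
    u @ \oo --> ul.
  move=> l0 uK; rewrite -(cvg_shiftS u).
  have /= u0 := cvg0_of_sqr_le l0 uK (mul0 _ K P0).
  rewrite (_ : (fun k => _) = (fun k => u k.+1 - ul + ul)).
    have := cvgD u0 (cvg_cst ul : (fun _ : nat => ul) @ \oo --> ul).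
    by rewrite add0r; apply.
  by apply/funext => k; rewrite subrK.
split.
- by apply: (fin _ _ _ lx (3 + 2 / ka)) => // k;
    have [] := potential_coercive zl k kcl.
- by apply: (fin _ _ _ ly 1) => // k; rewrite mul1r;
    have [] := potential_coercive zl k kcl.
- by apply: (fin _ _ _ 1 (tau * sigma)) => // k; rewrite mul1r;
    have [] := potential_coercive zl k kcl.
Unshelve. all: by end_near. Qed.

End TwoBlock.

(** * Symmetric Gauss-Seidel *)

Section Blocks.
Context {R : realType} {n : nat} (X : 'I_n -> euclideanType R).
Local Notation P := (hprod X).
Implicit Types (u v w : P) (M : 'End(P)).

Lemma hinj_in i (a : X i) : hinj X i a i = a.
Proof. by rewrite hinjE hprod_tupleE dfwith_in. Qed.

Lemma hinj_out i (a : X i) j : i != j -> hinj X i a j = 0.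
Proof. by move=> ij; rewrite hinjE hprod_tupleE dfwith_out. Qed.

Lemma inner_hinjl i (a : X i) w : inner (hinj X i a) w = inner a (w i).
Proof.
rewrite hprod_innerE (bigD1 i)//= hinj_in big1 ?addr0// => j ji.
by rewrite hinj_out 1?eq_sym// inner0l.
Qed.

Lemma inner_hinjr i (a : X i) w : inner w (hinj X i a) = inner (w i) a.
Proof. by rewrite innerC inner_hinjl innerC. Qed.

Lemma hprod_sum (I : finType) (S : pred I) (F : I -> P) j :
  (\sum_(i | S i) F i) j = \sum_(i | S i) F i j.
Proof.
rewrite -hprojE linear_sum /=; apply: eq_bigr => i _; exact: hprojE.
Qed.

Lemma hprodNE u i : (- u) i = - u i.
Proof. by rewrite -scaleN1r hprodZE scaleN1r. Qed.

Lemma hprod_decomp u : u = \sum_j hinj X j (u j).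
Proof.
apply: hprodP => i; rewrite hprod_sum (bigD1 i)//= hinj_in.
by rewrite big1 ?addr0// => j ji; rewrite hinj_out.
Qed.

Lemma blockE M i j (a : X j) : block M i j a = M (hinj X j a) i.
Proof. by rewrite /block !comp_lfunE hprojE. Qed.

Lemma hom_blockE M w i : M w i = \sum_j block M i j (w j).
Proof.
rewrite {1}(hprod_decomp w) linear_sum /= hprod_sum.
by apply: eq_bigr => j _; rewrite blockE.
Qed.

Lemma block_diagE M w i : block_diag M w i = block M i i (w i).
Proof.
rewrite /block_diag sum_lfunE hprod_sum (bigD1 i)//= !comp_lfunE hinj_in.
rewrite !hprojE big1 ?addr0// => j ji.
by rewrite !comp_lfunE hinj_out.
Qed.

Lemma block_upperE M w i :
  block_upper M w i = \sum_(j < n | (i < j)%N) block M i j (w j).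
Proof.
rewrite /block_upper sum_lfunE hprod_sum (bigD1 i)//= sum_lfunE hprod_sum.
rewrite [X in _ + X]big1 ?addr0 => [|j ji]; last first.
  rewrite sum_lfunE hprod_sum big1// => k _.
  by rewrite !comp_lfunE hinj_out.
by apply: eq_bigr => j _; rewrite !comp_lfunE hinj_in !hprojE.
Qed.

Lemma inner_block M i j (a : X j) (b : X i) : self_adjoint M ->
  inner (block M i j a) b = inner a (block M j i b).
Proof.
move=> /self_adjointP sM; rewrite !blockE -inner_hinjr -sM inner_hinjl.
by [].
Qed.

Lemma adjoint_block_upperE M w i : self_adjoint M ->
  adjoint (block_upper M) w i = \sum_(j < n | (j < i)%N) block M i j (w j).
Proof.
move=> sM; pose L : P := hprod_tuple (fun i => \sum_(j < n | (j < i)%N) block M i j (w j)).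
rewrite (_ : adjoint _ w = L) ?hprod_tupleE//; apply: inner_inj => u.
rewrite innerC -adjointP !hprod_innerE.
under eq_bigr => k _ do rewrite block_upperE innerC linear_sum /=.
under [RHS]eq_bigr => k _ do rewrite /L hprod_tupleE innerC linear_sum /=.
rewrite (exchange_big_dep predT)//=; apply: eq_bigr => k _.
by apply: eq_bigr => j _; rewrite innerC inner_block.
Qed.

End Blocks.

Section Splice.
Context {R : realType} {n : nat} (X : 'I_n -> euclideanType R).
Local Notation P := (hprod X).
Implicit Types (u v w : P).

Lemma splice_eq u i (a : X i) w : splice u a w i = a.
Proof. by rewrite /splice hprod_tupleE dfwith_in. Qed.

Lemma splice_neq u i (a : X i) w j : i != j ->
  splice u a w j = if (j < i)%N then u j else w j.
Proof. by move=> ij; rewrite /splice hprod_tupleE dfwith_out. Qed.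

Lemma splice_add u i (a b : X i) w :
  splice u (a + b) w = splice u a w + hinj X i b.
Proof.
apply: hprodP => j; rewrite hprodDE; have [ij|ij] := eqVneq i j.
  by move: ij a b => -> a b; rewrite !splice_eq hinj_in.
by rewrite !splice_neq// hinj_out// addr0.
Qed.

Lemma splice_conv u i (a b : X i) w (t : R) :
  splice u (t *: a + (1 - t) *: b) w = t *: splice u a w + (1 - t) *: splice u b w.
Proof.
apply: hprodP => j; rewrite hprodDE !hprodZE; have [ij|ij] := eqVneq i j.
  by move: ij a b => -> a b; rewrite !splice_eq.
by rewrite !splice_neq// -scalerDl addrCA subrr addr0 scale1r.
Qed.

End Splice.

Section SymmetricGaussSeidel.
Context {R : realType} {n : nat} (X : 'I_n.+1 -> euclideanType R).
Local Notation P := (hprod X).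
Variables (M : 'End(P)) (p1 : X ord0 -> \bar R).
Hypothesis saM : self_adjoint M.
Hypothesis pdMd : pd (block_diag M).
Hypothesis p1_gtNy : forall a, (-oo < p1 a)%E.
Hypothesis p1_convex : forall (a b : X ord0) (t : R), (0 <= t <= 1)%R ->
  (p1 (t *: a + (1 - t) *: b)%R <= t%:E * p1 a + (1 - t)%:E * p1 b)%E.

Let Mu := block_upper M.
Let Md := block_diag M.

Lemma subdifferential_first_block (v : P) g :
  subdifferential p1 (v ord0) g ->
  subdifferential (first_block p1) v (hinj X ord0 g).
Proof.
move=> [fv gP]; split=> // w; rewrite /first_block inner_hinjl hprodDE hprodNE.
exact: gP.
Qed.

Lemma subdifferential_splice (Q : P -> R) (G : P -> P) i (a : X i) (u w : P) d :
  (forall v h, Q (v + h) = Q v + inner (G v) h + 2^-1 * qform M h) ->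
  subdifferential (fun b : X i => (first_block p1 (splice u b w)
    + (Q (splice u b w))%:E)%E) a d ->
  subdifferential (fun b : X i => first_block p1 (splice u b w)) a
    (d - G (splice u a w) i).
Proof.
move=> QE; apply: (@subdifferential_quadratic _ _ _ _ (block M i i)).
- by move=> b; exact: p1_gtNy.
- move=> b c t t01; rewrite /first_block splice_conv hprodDE !hprodZE.
  exact: p1_convex.
- by move=> b; rewrite splice_add QE inner_hinjr /qform inner_hinjl -blockE.
Qed.

Lemma sum_norm_le (d : P) (eps : R) :
  (forall i, `|d i| <= eps) -> `|d| <= n.+1%:R * eps.
Proof.
move=> de; rewrite (hprod_decomp d) (le_trans (ler_norm_sum _ _ _))//.
have -> : n.+1%:R * eps = \sum_(i < n.+1) eps.
  by rewrite sumr_const card_ord mulr_natl.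
apply: ler_sum => i _; rewrite (le_trans _ (de i))//.
rewrite -(@ler_pXn2r _ 2)// ?nnegrE// -!inner_norm inner_hinjl hinj_in.
by [].
Qed.

(* With [ut_0 := v_0] and [gam] the subgradient of [p], the two sweeps read
   [dt = G v + Mu^* (u - v) + (Md + Mu) (ut - v) + gam] and
   [de = G v + Mu (ut - v) + gam]; their difference determines [ut - v]. *)
Lemma sGS_cycle_optimality : exists2 C, 0 < C &
  forall (Q : P -> R) (G : P -> P) (eps : R) (u ut v : P),
  (forall w h, Q (w + h) = Q w + inner (G w) h + 2^-1 * qform M h) ->
  (forall w w', G w = G w' + M (w - w')) ->
  sGS_cycle (fun w => first_block p1 w + (Q w)%:E)%E eps u ut v ->
  exists2 d, `|d| <= C * eps &
    subdifferential (first_block p1) v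
      (d - G v - (Mu \o Md^-1 \o adjoint Mu)%VF (v - u)).
Proof.
have [C0 C00 C0P] := hom_bounded (Mu \o Md^-1)%VF.
exists (n.+1%:R * (1 + 2 * C0)); first by rewrite mulr_gt0//; lra.
move=> Q G eps u ut v QE GE [back forw].
have [d0 d0P d0e] := forw ord0.
pose s := splice v (v ord0) ut.
pose g := d0 - G s ord0.
have gP : subdifferential p1 (v ord0) g.
  have := subdifferential_splice QE d0P; rewrite -/g /first_block.
  by under [X in subdifferential X]funext => b do rewrite splice_eq.
pose ut' : P := hprod_tuple (fun i => splice ut (v ord0) ut i).
pose a := ut' - v; pose gam := hinj X ord0 g.
have utN i : i != ord0 -> ut' i = ut i.
  by move=> i0; rewrite hprod_tupleE splice_neq 1?eq_sym// if_same.
have ut0 : ut' ord0 = v ord0 by rewrite hprod_tupleE splice_eq.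
have const_sub i (b : X i) z w d : i != ord0 ->
    subdifferential (fun b' : X i => first_block p1 (splice z b' w)) b d -> d = 0.
  move=> i0 [fb /(_ (b + d))].
  have spl (b' : X i) : splice z b' w ord0 = z ord0.
    by rewrite splice_neq// lt0n i0.
  rewrite /first_block spl in fb *; rewrite spl addrAC subrr add0r -(fineK fb).
  rewrite -EFinD lee_fin gerDl => dd; apply/eqP; rewrite -inner_eq0.
  by rewrite eq_le dd inner_ge0.
have gam0 : gam ord0 = g by rewrite /gam hinj_in.
have gamN i : i != ord0 -> gam i = 0.
  by move=> i0; rewrite /gam hinj_out// eq_sym.
have Gs i : G (splice v (v i) ut) i = G v i + Mu a i.
  rewrite (GE _ v) hprodDE; congr (_ + _).
  rewrite hom_blockE block_upperE [RHS]big_mkcond; apply: eq_bigr => j _.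
  rewrite hprodDE hprodNE; have [ij|ij] := eqVneq i j.
    by rewrite -ij splice_eq subrr linear0 ltnn.
  rewrite splice_neq//; case: ltngtP => // [ji|ji|/val_inj/eqP]; last first.
  - by rewrite eq_sym (negbTE ij).
  - by rewrite /a hprodDE hprodNE utN// -lt0n (leq_ltn_trans _ ji).
  - by rewrite subrr linear0.
have Gst i : i != ord0 -> G (splice u (ut i) ut) i =
    G v i + Mu a i + (adjoint Mu (u - v) i + Md a i).
  move=> i0; rewrite (GE _ v) hprodDE -addrA; congr (_ + _).
  rewrite hom_blockE block_upperE adjoint_block_upperE// block_diagE.
  rewrite -(big_pred1_eq +%R i (fun j => block M i j (a j))).
  rewrite [X in X + (_ + _)]big_mkcond [X in _ + (X + _)]big_mkcond.
  rewrite [X in _ + (_ + X)]big_mkcond -!big_split /=; apply: eq_bigr => j _.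
  rewrite [X in block M i j X]hprodDE hprodNE. have [ij|ij] := eqVneq i j.
    by rewrite -ij splice_eq ltnn !add0r /a hprodDE hprodNE utN.
  rewrite splice_neq// addr0.
  case: ltngtP => // [ji|ji|/val_inj/eqP]; last first.
  - by rewrite eq_sym (negbTE ij).
  - by rewrite addr0 /a hprodDE hprodNE utN// -lt0n (leq_ltn_trans _ ji).
  - by rewrite add0r hprodDE hprodNE.
pose de := G v + Mu a + gam.
have de0 : de ord0 = d0.
  by rewrite /de hprodDE (hprodDE (G v)) -Gs gam0 /g addrC subrK.
have deE i : `|de i| <= eps.
  have [->|i0] := eqVneq i ord0; first by rewrite de0.
  have [d dP] := forw i.
  have /(const_sub _ _ _ _ _ i0)/subr0_eq := subdifferential_splice QE dP.
  by rewrite /de hprodDE (hprodDE (G v)) -Gs (gamN _ i0) addr0 => ->.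
pose dt := de + (adjoint Mu (u - v) + Md a).
have dtE i : `|dt i| <= eps.
  rewrite hprodDE (hprodDE (adjoint _ _)); have [->|i0] := eqVneq i ord0.
    rewrite adjoint_block_upperE// big_pred0// block_diagE /a hprodDE hprodNE.
    by rewrite ut0 subrr linear0 !addr0 de0.
  have [d dP] := back i i0.
  have /(const_sub _ _ _ _ _ i0)/subr0_eq := subdifferential_splice QE dP.
  rewrite Gst// /de hprodDE (hprodDE (G v)) (gamN _ i0) addr0.
  by move=> ->.
pose K := (Mu \o Md^-1)%VF.
have MuaE : Mu a = K (dt - de) + K (adjoint Mu (v - u)).
  have -> : dt - de = adjoint Mu (u - v) + Md a by rewrite /dt addrC addKr.
  rewrite -linearD /= addrAC -linearD /=.
  rewrite addrA subrK subrr linear0 add0r /K comp_lfunE.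
  by rewrite lker0_lfunK// pd_lker0.
exists (de - K (dt - de)).
  rewrite (le_trans (ler_normB _ _))//.
  have -> : n.+1%:R * (1 + 2 * C0) * eps =
      n.+1%:R * eps + C0 * (n.+1%:R * eps + n.+1%:R * eps) by ring.
  rewrite lerD ?sum_norm_le// (le_trans (C0P _))// ler_wpM2l ?(ltW C00)//.
  by rewrite (le_trans (ler_normB _ _))// lerD// sum_norm_le.
rewrite (_ : _ - _ = gam); first exact: subdifferential_first_block.
apply/eqP; rewrite 3!subr_eq [X in X == _](_ : _ = G v + Mu a + gam)// MuaE.
rewrite [X in _ == _ + X + _ + _]comp_lfunE -/K.
move: (K (dt - de)) (K (adjoint Mu (v - u))) (gam) (G v) => k1 k2 b c.
by apply/eqP; rewrite addrC -!addrA (addrCA k2) (addrC k2).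
Qed.

End SymmetricGaussSeidel.

Section OneBlock.
Context {R : realType} {n : nat} (X : 'I_n.+1 -> euclideanType R).
Context {Z : euclideanType R}.
Variables (A : 'Hom(Z, hprod X)) (sigma : R) (Sf S : 'End(hprod X)).
Hypothesis saSf : self_adjoint Sf.
Hypothesis saS : self_adjoint S.
Hypothesis diag_pd : forall i, let Ai := (hproj X i \o A)%VF in
  pd (block Sf i i + sigma *: (Ai \o adjoint Ai)%VF + block S i i).

Local Notation M := (prox_hessian A sigma Sf S).
Local Notation Sx := (sGS_operator A sigma Sf S).

Lemma self_adjoint_prox_hessian : self_adjoint M.
Proof.
apply: self_adjointD => //; apply: self_adjointD => //; apply: self_adjointZ.
exact: self_adjoint_comp_adjoint.
Qed.

Lemma block_diag_prox_hessian_pd : pd (block_diag M).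
Proof.
have diagE i a : qform (block M i i) a = qform (block Sf i i
    + sigma *: ((hproj X i \o A) \o adjoint (hproj X i \o A))%VF + block S i i) a.
  have bl (H : 'End(hprod X)) : qform (block H i i) a = qform H (hinj X i a).
    by rewrite /qform blockE inner_hinjl.
  rewrite bl /prox_hessian !qformDl !qformZl !bl !qform_comp_adjoint.
  congr (_ + sigma * `|_| ^+ 2 + _); apply: inner_inj => z.
  rewrite innerC -adjointP innerC [RHS]innerC -adjointP comp_lfunE hprojE.
  by rewrite inner_hinjl innerC.
move=> u u0; have [i ui] : exists i, u i != 0.
  apply/existsP; apply: contraNT u0; rewrite negb_exists => /forallP u0.
  by apply/eqP/hprodP => i; rewrite hprod0E; apply/eqP/negbNE/u0.
rewrite /qform hprod_innerE (bigD1 i)//= block_diagE ltr_pwDl//.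
  by have := diag_pd ui; rewrite -diagE.
apply: sumr_ge0 => j _; rewrite block_diagE.
by have := pd_psd (@diag_pd j) (u j); rewrite -diagE.
Qed.

Local Notation Mu := (block_upper M).
Local Notation Md := (block_diag M).

Lemma self_adjoint_block_diag : self_adjoint Md.
Proof.
apply/self_adjointP => u v; rewrite !hprod_innerE; apply: eq_bigr => i _.
by rewrite !block_diagE inner_block//; exact: self_adjoint_prox_hessian.
Qed.

Lemma sGS_termE u w : inner u ((Mu \o Md^-1 \o adjoint Mu)%VF w) =
  inner (adjoint Mu u) ((Md^-1)%VF (adjoint Mu w)).
Proof.
by rewrite !comp_lfunE [LHS]innerC (adjointP Mu) innerC.
Qed.

Lemma self_adjoint_sGS_operator : self_adjoint Sx.
Proof.
apply: self_adjointD => //; apply/self_adjointP => u v.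
rewrite [RHS]innerC !sGS_termE [RHS]innerC.
have /self_adjointP -> // := self_adjoint_inv self_adjoint_block_diag
  block_diag_prox_hessian_pd.
Qed.

Lemma sGS_operator_ge : loewner_le (- (2^-1 *: Sf)) S -> forall u,
  0 <= 2^-1 * qform Sf u + qform Sx u.
Proof.
move=> S_ge u; have tE : qform (Mu \o Md^-1 \o adjoint Mu)%VF u =
  qform (Md^-1)%VF (adjoint Mu u) := sGS_termE u u.
rewrite /sGS_operator qformDl tE; have := S_ge u; rewrite opprK qformDl qformZl.
have := psd_inv self_adjoint_block_diag block_diag_prox_hessian_pd (adjoint Mu u).
lra.
Qed.

Lemma sGS_operator_coercive :
  pd (2^-1 *: Sf + sigma *: (A \o adjoint A)%VF + Sx) -> exists2 l, 0 < l & forall u,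
  l * `|u| ^+ 2 <= 2^-1 * qform Sf u + qform Sx u + sigma * `|adjoint A u| ^+ 2.
Proof.
move=> sum_pd; have [l l0 lP] := pd_lower_bound (self_adjointD (self_adjointD
  (self_adjointZ 2^-1 saSf) (self_adjointZ sigma (self_adjoint_comp_adjoint A)))
  self_adjoint_sGS_operator) sum_pd.
exists l => // u; rewrite (le_trans (lP u))//.
by rewrite !qformDl !qformZl qform_comp_adjoint; lra.
Qed.

Variables (p1 : X ord0 -> \bar R) (f : hprod X -> R).
Hypothesis p1_cpc : closed_proper_convex p1.

Definition prox_objective (K : R) (t : Z) (x0 : hprod X) (z0 : Z) (w : hprod X) : R :=
  K + majorant f Sf w x0 + inner z0 (adjoint A w + t)
  + sigma / 2 * `|adjoint A w + t| ^+ 2 + 2^-1 * qform S (w - x0).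

Definition prox_gradient (t : Z) (x0 : hprod X) (z0 : Z) (w : hprod X) : hprod X :=
  grad f x0 + Sf (w - x0) + A z0 + sigma *: A (adjoint A w + t) + S (w - x0).

Lemma prox_objectiveE K t x0 z0 w h :
  prox_objective K t x0 z0 (w + h) = prox_objective K t x0 z0 w
  + inner (prox_gradient t x0 z0 w) h + 2^-1 * qform M h.
Proof.
rewrite /prox_objective /prox_gradient /majorant /prox_hessian.
rewrite !qformDl !qformZl qform_comp_adjoint.
have := adjointP A; move: (adjoint A) (grad f x0) => At gx AtP.
rewrite (linearD At) /= (addrAC w) (addrAC (At w)).
move: (w - x0) (At w + t) => d r.
rewrite (qformD d h saSf) (qformD d h saS) -!inner_norm !innerE !AtP.
rewrite (innerC (At h) r) -!((self_adjointP _).1 saSf) -!((self_adjointP _).1 saS).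
by field.
Qed.

Lemma prox_gradientB t x0 z0 w w' :
  prox_gradient t x0 z0 w = prox_gradient t x0 z0 w' + M (w - w').
Proof.
rewrite /prox_gradient /prox_hessian !add_lfunE scale_lfunE comp_lfunE.
move: (adjoint A) (grad f x0) => At gx; apply: inner_inj => h.
rewrite !(linearB Sf) !(linearB S) (linearB At) (linearD A (At w)) (linearD A (At w')).
by rewrite /= (linearB A) /= !innerE; ring.
Qed.

Lemma sGS_cycle_prox_step : exists2 C, 0 < C &
  forall K t x0 z0 eps xt v,
  sGS_cycle (fun w => first_block p1 w + (prox_objective K t x0 z0 w)%:E)%E
    eps x0 xt v ->
  exists2 d, `|d| <= C * eps & subdifferential (first_block p1) v
    (d - grad f x0 - A z0 - sigma *: A (adjoint A v + t) - (Sf + Sx) (v - x0)).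
Proof.
have [p1_gtNy _ p1_conv _] := p1_cpc.
have [C C0 CP] := sGS_cycle_optimality self_adjoint_prox_hessian
  block_diag_prox_hessian_pd p1_gtNy p1_conv.
exists C => // K t x0 z0 eps xt v cyc.
have [d de dP] := CP _ _ _ _ _ _ (prox_objectiveE K t x0 z0)
  (prox_gradientB t x0 z0) cyc.
exists d => //; move: dP; rewrite /prox_gradient /sGS_operator.
rewrite 2!add_lfunE.
move: (grad f x0) (A z0) (sigma *: _) (Sf _) (S _) ((_ \o _)%VF _).
move=> g a b s1 s2 k.
by rewrite !opprD !addrA (addrAC _ (- s1) (- a)) (addrAC _ (- s1) (- b)).
Qed.

End OneBlock.

(** * Convergence of sGS-imiPADMM *)

Lemma KKT_setP (R : realType) (V W Z : euclideanType R)
    (p : V -> \bar R) (q : W -> \bar R) (f : V -> R) (g : W -> R)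
    (A : 'Hom(Z, V)) (B : 'Hom(Z, W)) (c : Z) x y z :
  KKT_set p q f g A B c (x, y, z) <->
  kkt p q (grad f) (grad g) A B (adjoint A) (adjoint B) c x y z.
Proof.
have opp (U : zmodType) (u a b : U) : 0 = u + a + b -> u = - a - b.
  by move=> /esym/eqP; rewrite -addrA addr_eq0 opprD => /eqP.
split=> [[[u up /opp ue] [v vq /opp ve] xyc]|[xp yq xyc]].
  by split=> //; rewrite -?ue -?ve.
split=> //; first by exists (- grad f x - A z) => //; rewrite addrAC subrK addNr.
by exists (- grad g y - B z) => //; rewrite addrAC subrK addNr.
Qed.

Theorem theorem3p1 (R : realType) (m n : nat)
    (X : 'I_m.+1 -> euclideanType R) (Y : 'I_n.+1 -> euclideanType R)
    (Z : euclideanType R)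
    (p1 : X ord0 -> \bar R) (q1 : Y ord0 -> \bar R)
    (f : hprod X -> R) (g : hprod Y -> R)
    (A : 'Hom(Z, hprod X)) (B : 'Hom(Z, hprod Y)) (c : Z)
    (sigma : R) (Sf S : 'End(hprod X)) (Sg T : 'End(hprod Y))
    (tau : R) (eps : nat -> R)
    (x xt : nat -> hprod X) (y yt : nat -> hprod Y) (z : nat -> Z) :
  closed_proper_convex p1 -> closed_proper_convex q1 ->
  convex_C1_lipschitz_grad f -> convex_C1_lipschitz_grad g ->
  0 < sigma ->
  (* (i) *)
  KKT_set (first_block p1) (first_block q1) f g A B c !=set0 ->
  (* (ii) *)
  self_adjoint Sf -> psd Sf -> (forall u u', f u <= majorant f Sf u u') ->
  self_adjoint Sg -> psd Sg -> (forall v v', g v <= majorant g Sg v v') ->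
  (* (iii) *)
  self_adjoint S -> loewner_le (- (2^-1 *: Sf)) S ->
  self_adjoint T -> loewner_le (- (2^-1 *: Sg)) T ->
  (forall i, let Ai := (hproj X i \o A)%VF in
     pd (block Sf i i + sigma *: (Ai \o adjoint Ai)%VF + block S i i)) ->
  (forall j, let Bj := (hproj Y j \o B)%VF in
     pd (block Sg j j + sigma *: (Bj \o adjoint Bj)%VF + block T j j)) ->
  (* choice of S and T *)
  pd (2^-1 *: Sf + sigma *: (A \o adjoint A)%VF + sGS_operator A sigma Sf S) ->
  pd (2^-1 *: Sg + sigma *: (B \o adjoint B)%VF + sGS_operator B sigma Sg T) ->
  (* parameters of the algorithm *)
  0 < tau < (1 + Num.sqrt 5) / 2 ->
  (forall k, 0 <= eps k) -> cvgn (series eps) ->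
  sGS_imiPADMM p1 q1 f g A B c sigma Sf S Sg T tau eps x xt y yt z ->
  exists xs ys zs,
    KKT_set (first_block p1) (first_block q1) f g A B c (xs, ys, zs) /\
    [/\ x @ \oo --> xs, y @ \oo --> ys & z @ \oo --> zs].
Proof.
move=> p1P q1P fP gP s0 [[[xb yb] zb] /KKT_setP kb] saSf psdSf majf saSg psdSg majg.
move=> saS Sge saT Tge pdS pdT sumS sumT tauP eps0 eps_sum [_ [y0 alg]].
have [Cx Cx0 stepx] := sGS_cycle_prox_step saSf saS pdS f p1P.
have [Cy Cy0 stepy] := sGS_cycle_prox_step saSg saT pdT g q1P.
have lag_x k : first_block q1 (y k) \is a fin_num -> exists2 d, `|d| <= Cx * eps k &
    xoptimal (first_block p1) (grad f) A (adjoint A) (adjoint B) c sigma Sf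
      (sGS_operator A sigma Sf S) (x k) (x k.+1) (y k) (z k) d.
  move=> qy; have [+ _ _] := alg k.
  rewrite (_ : (fun u => _) = (fun u => first_block p1 u + (prox_objective A sigma
    Sf S f (fine (first_block q1 (y k)) + majorant g Sg (y k) (y k)
     + 2^-1 * qform T (y k - y k)) (adjoint B (y k) - c) (x k) (z k) u)%:E)%E).
    by move=> /stepx[d de dP]; exists d => //; rewrite (addrA (adjoint A _)) in dP.
  apply/funext => u; rewrite /majorized_lagrangian -{1}(fineK qy).
  rewrite -!addeA -!EFinD; congr (_ + _%:E)%E.
  by rewrite /prox_objective (addrA (adjoint A u)); ring.
have lag_y k : first_block p1 (x k.+1) \is a fin_num -> exists2 d, `|d| <= Cy * eps k &
    yoptimal (first_block q1) (grad g) B (adjoint A) (adjoint B) c sigma Sg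
      (sGS_operator B sigma Sg T) (x k.+1) (y k) (y k.+1) (z k) d.
  move=> px; have [_ + _] := alg k.
  rewrite (_ : (fun v => _) = (fun v => first_block q1 v + (prox_objective B sigma
    Sg T g (fine (first_block p1 (x k.+1)) + majorant f Sf (x k.+1) (x k)
     + 2^-1 * qform S (x k.+1 - x k)) (adjoint A (x k.+1) - c) (y k) (z k) v)%:E)%E).
    move=> /stepy[d de dP]; exists d => //.
    by rewrite /yoptimal (addrC (adjoint A _)); rewrite (addrA (adjoint B _)) in dP.
  apply/funext => v; rewrite /majorized_lagrangian -{1}(fineK px).
  rewrite -EFinD (addeC _ (first_block q1 v)) -!addeA -!EFinD.
  congr (_ + _%:E)%E.
  by rewrite /prox_objective (addrA (adjoint B v)) (addrC (adjoint B v)); ring.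
have qfin k : first_block q1 (y k) \is a fin_num.
  elim: k => [|k /lag_x[d _ [/lag_y[d' _ []]]]//].
  move: y0; rewrite /dom /= /first_block; have [+ _ _ _] := q1P.
  by move=> /(_ (y 0%N ord0)); case: (q1 _).
have exx k : exists d, `|d| <= Cx * eps k /\
    xoptimal (first_block p1) (grad f) A (adjoint A) (adjoint B) c sigma Sf
      (sGS_operator A sigma Sf S) (x k) (x k.+1) (y k) (z k) d.
  by have [d] := lag_x k (qfin k); exists d.
have [dx dxP] := choice exx.
have exy k : exists d, `|d| <= Cy * eps k /\
    yoptimal (first_block q1) (grad g) B (adjoint A) (adjoint B) c sigma Sg
      (sGS_operator B sigma Sg T) (x k.+1) (y k) (y k.+1) (z k) d.
  by have [_ [px _]] := dxP k; have [d] := lag_y k px; exists d.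
have [dy dyP] := choice exy.
have [lx lx0 lxP] := sGS_operator_coercive saSf saS pdS sumS.
have [ly ly0 lyP] := sGS_operator_coercive saSg saT pdT sumT.
have [al [ka [al0 ka0 young]]] := step_length_young tauP.
have [tau0 _] := andP tauP.
have first_cpc (k : nat) (U : 'I_k.+1 -> euclideanType R) (r : U ord0 -> \bar R) :
    closed_proper_convex r -> [/\ forall u, (-oo < first_block r u)%E,
      dom (first_block r) !=set0 & lower_semicontinuous (first_block r)].
  move=> [rNy [a ra] _ rl]; split=> [u||u b].
  - exact: rNy.
  - by exists (hinj U ord0 a); rewrite /dom /= /first_block hinj_in.
  - move=> /rl[N Nu Nb]; exists (hproj U ord0 @^-1` N).
      by apply: hom_continuous; rewrite hprojE.
    by move=> w /= Nw; apply: Nb; rewrite -hprojE.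
have [pNy pdom plsc] := first_cpc _ _ _ p1P.
have [qNy qdom qlsc] := first_cpc _ _ _ q1P.
have e_sum : cvgn (series (fun k => (Cx + Cy) * eps k)).
  by move: eps_sum => /(@is_cvg_seriesZ _ _ (Cx + Cy)).
have [||xs [ys [zs [ks cvs]]]] := two_block_convergence
  (fun z v => adjointP A z v) (fun z v => adjointP B z v)
  (fun x y z => grad_cocoercive x y z fP majf)
  (fun x y z => grad_cocoercive x y z gP majg)
  saSf (self_adjoint_sGS_operator saSf saS pdS)
  saSg (self_adjoint_sGS_operator saSg saT pdT)
  (sGS_operator_ge saSg saT pdT Tge) s0 tau0 psdSf psdSg
  (sGS_operator_ge saSf saS pdS Sge) lx0 ly0 lxP lyP al0 ka0 (young Z)
  (fun k => (dxP k).2) (fun k => (dyP k).2) (fun k => let: And3 _ _ h := alg k in h)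
  _ _ e_sum (let: And4 _ _ h _ := fP in h) (let: And4 _ _ h _ := gP in h)
  pNy qNy pdom qdom plsc qlsc (ex_intro _ xb (ex_intro _ yb (ex_intro _ zb kb))).
- by move=> k; have [+ _] := dxP k; have := mulr_ge0 (ltW Cy0) (eps0 k); lra.
- by move=> k; have [+ _] := dyP k; have := mulr_ge0 (ltW Cx0) (eps0 k); lra.
by exists xs, ys, zs; split=> //; apply/KKT_setP.
Qed.
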